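(* Let $N\ge 3$, $2<p,q<2+\frac4N$, $\alpha,\beta>1$, $\alpha+\beta=2^*:=\frac{2N}{N-2}$, $\mu_1,\mu_2,a,b>0$, let $\nu_0,\rho_0$ be the constants described in the context, $\nu\in(0,\nu_0)$, $(a_1,b_1)\in(0,a]\times(0,b]$. Let $(u_0,v_0)\in A_{\rho_0}^{a_1,b_1}$, with $u_0,v_0>0$ Schwarz symmetric, satisfy $J(u_0,v_0)=m_\nu(a_1,b_1)$, and let $\lambda_1,\lambda_2\in\mathbb R$ be the corresponding Lagrange multipliers, so that $$\begin{cases}-\Delta u_0+\lambda_1u_0=\mu_1u_0^{p-1}+\nu\alpha u_0^{\alpha-1}v_0^\beta,\\-\Delta v_0+\lambda_2v_0=\mu_2v_0^{q-1}+\nu\beta u_0^\alpha v_0^{\beta-1}\end{cases}\quad\text{in }\mathbb R^N.$$ (i) If $N=3,4$, then $\lambda_1>0$ and $\lambda_2>0$. (ii) If $N\ge5$, then $\lambda_1\ge0$, $\lambda_2\ge0$ and at least one of them is positive. Furthermore, if $p\le\frac{2N-2}{N-2}$ then $\lambda_1>0$, while if $q\le\frac{2N-2}{N-2}$ then $\lambda_2>0$.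
   Context: The energy functional is $$J(u,v)=\tfrac12(\|\nabla u\|_2^2+\|\nabla v\|_2^2)-\tfrac{\mu_1}{p}\|u\|_p^p-\tfrac{\mu_2}{q}\|v\|_q^q-\nu\int_{\mathbb R^N}|u|^\alpha|v|^\beta\,dx ,\quad (u,v)\in H^1(\mathbb R^N,\mathbb R^2).$$ $T(a_1,b_1):=\{(u,v)\in H^1(\mathbb R^N,\mathbb R^2):\|u\|_2^2=a_1,\ \|v\|_2^2=b_1\}$, $A_{\rho}^{a_1,b_1}:=\{(u,v)\in T(a_1,b_1):\|\nabla u\|_2^2+\|\nabla v\|_2^2<\rho\}$, $B_{\rho}^{a_1,b_1}:=\{(u,v)\in T(a_1,b_1):\rho\le\|\nabla u\|_2^2+\|\nabla v\|_2^2\le2\rho\}$, $m_\nu(a_1,b_1):=\inf_{A_{\rho_0}^{a_1,b_1}}J$. Here $\nu_0,k_0,\rho_0>0$ are fixed constants depending only on $a,b$ and the data $N,p,q,\alpha,\beta,\mu_1,\mu_2$ such that for all $(a_1,b_1)\in[0,a]\times[0,b]\setminus\{(0,0)\}$ and all $\nu\in(0,\nu_0)$: $\inf_{A_{\rho_0}^{a_1,b_1}}J<0<k_0\le\inf_{B_{\rho_0}^{a_1,b_1}}J$ (such constants exist). A Schwarz symmetric function is a nonnegative function radially symmetric about the origin and non-increasing in $|x|$. *)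

(* Defs.v *)
From HB Require Import structures.
From mathcomp Require Import all_boot all_order all_algebra.
From mathcomp Require Import all_classical all_reals all_analysis.

Set Implicit Arguments.
Unset Strict Implicit.
Unset Printing Implicit Defensive.

Import Order.TTheory GRing.Theory Num.Theory.
Import numFieldNormedType.Exports.

Local Open Scope classical_set_scope.
Local Open Scope ring_scope.

(* R^n is 'rV[R]_n, with the Borel sigma-algebra, presented (as the library
   does for n.-tuple) as the one generated by the coordinates. *)
Section measurable_rV.
Context (R : realType) (n : nat).

Definition rV_coord (i : 'I_n) (x : 'rV[R]_n) : measurableTypeR R := x ord0 i.

Let rV_set0 : g_sigma_preimage rV_coord set0.
Proof. exact: sigma_algebra0. Qed.

Let rV_setC A : g_sigma_preimage rV_coord A -> g_sigma_preimage rV_coord (~` A).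
Proof. exact: sigma_algebraC. Qed.

Let rV_bigcup (F : (set 'rV[R]_n)^nat) :
  (forall i, g_sigma_preimage rV_coord (F i)) ->
  g_sigma_preimage rV_coord (\bigcup_i (F i)).
Proof. exact: sigma_algebra_bigcup. Qed.

HB.instance Definition _ :=
  @isMeasurable.Build (measure_tuple_display default_measure_display)
    'rV[R]_n (g_sigma_preimage rV_coord) rV_set0 rV_setC rV_bigcup.

End measurable_rV.

Lemma measurable_rV_coord (R : realType) n (i : 'I_n) :
  measurable_fun [set: 'rV[R]_n] (@rV_coord R n i).
Proof.
move=> _ Y mY; rewrite setTI; apply: sub_sigma_algebra => /=.
rewrite -bigcup_seq/=; exists i => /=; first by rewrite mem_index_enum.
by exists Y => //; rewrite setTI.
Qed.

Lemma measurable_fun_rVP d (T : measurableType d) (R : realType) n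
    (f : T -> 'rV[R]_n) :
  (forall i, measurable_fun [set: T] (rV_coord i \o f)) ->
  measurable_fun [set: T] f.
Proof.
move=> mf _ A mA; rewrite setTI.
suff : preimage_set_system setT f (g_sigma_preimage (@rV_coord R n)) `<=`
    measurable.
  by apply; exists A => //; rewrite setTI.
rewrite -g_sigma_preimage_comp.
apply: smallest_sub; first exact: sigma_algebra_measurable.
rewrite -bigcup_seq => B [i _ [C mC <-]].
exact: mf.
Qed.

(* Lebesgue measure on R^n: L^0 is the Dirac mass of the point R^0, and
   L^(n+1) is the product L^1 x L^n transported to 'rV_(n+1). *)
Section lebesgue_rV_succ.
Context (R : realType) (n : nat).
Variable mu : {sigma_finite_measure set 'rV[R]_n -> \bar R}.

Definition rV_cons (z : measurableTypeR R * 'rV[R]_n) : 'rV[R]_n.+1 :=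
  row_mx (z.1 : R)%:M z.2.

Lemma measurable_rV_cons : measurable_fun setT rV_cons.
Proof.
apply: measurable_fun_rVP => i.
rewrite -(splitK (i : 'I_(1 + n))); case: (fintype.split _) => j /=.
  rewrite (_ : _ \o _ = fst) //; apply/funext => z /=.
  by rewrite /rV_coord /rV_cons (row_mxEl _ _ ord0 j) mxE (ord1 j).
rewrite (_ : _ \o _ = rV_coord j \o snd).
  by apply: measurableT_comp => //; exact: measurable_rV_coord.
by apply/funext => z; exact: (@row_mxEr _ 1 1 n).
Qed.

Let rV_uncons (x : 'rV[R]_n.+1) : measurableTypeR R * 'rV[R]_n :=
  (rV_coord ord0 x, rsubmx (x : 'rV[R]_(1 + n))).

Let measurable_rV_uncons : measurable_fun setT rV_uncons.
Proof.
apply: measurable_fun_pair; first exact: measurable_rV_coord.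
apply: measurable_fun_rVP => i.
rewrite (_ : _ \o _ = rV_coord (rshift 1 i)); first exact: measurable_rV_coord.
by apply/funext => x; rewrite /= /rV_coord mxE.
Qed.

Let rV_consK : cancel rV_cons rV_uncons.
Proof.
move=> [x y]; congr pair; last exact: (@row_mxKr _ 1 1 n).
rewrite /rV_coord (_ : ord0 = lshift n (ord0 : 'I_1)); last exact: val_inj.
by rewrite [LHS](@row_mxEl _ 1 1 n) mxE.
Qed.

Definition lebesgue_rV_succ : set 'rV[R]_n.+1 -> \bar R :=
  pushforward (@lebesgue_measure R \x mu)%E rV_cons.

HB.instance Definition _ := Measure.copy lebesgue_rV_succ
  (measure_function_pushforward__canonical__measure_function_Measure
     (@lebesgue_measure R \x mu)%E measurable_rV_cons).

Let sigma_finite_lebesgue_rV_succ : sigma_finite setT lebesgue_rV_succ.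
Proof.
have /sigma_finiteP[F [TF ndF Foo]] := sigma_finiteT (@lebesgue_measure R).
have /sigma_finiteP[G [TG ndG Goo]] := sigma_finiteT mu.
exists (fun k => rV_uncons @^-1` (F k `*` G k)).
  apply/esym; rewrite -subTset => x _ /=.
  have [i _ Fi] : (\bigcup_i F i) (rV_uncons x).1 by rewrite -TF.
  have [j _ Gj] : (\bigcup_i G i) (rV_uncons x).2 by rewrite -TG.
  exists (maxn i j) => //; split.
  - by move: Fi; apply/subsetPset/ndF/leq_maxl.
  - by move: Gj; apply/subsetPset/ndG/leq_maxr.
move=> k; have [mF Fk] := Foo k; have [mG Gk] := Goo k; split.
  rewrite -[X in measurable X]setTI; apply: measurable_rV_uncons => //.
  exact: measurableX.
rewrite /lebesgue_rV_succ /pushforward -comp_preimage.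
rewrite (_ : _ \o _ = id) ?preimage_id; last exact/funext.
by rewrite product_measure1E// lte_mul_pinfty// ge0_fin_numE.
Qed.

HB.instance Definition _ := Measure_isSigmaFinite.Build _ _ _
  lebesgue_rV_succ sigma_finite_lebesgue_rV_succ.

End lebesgue_rV_succ.

Fixpoint lebesgue_rV (R : realType) (n : nat) :
    {sigma_finite_measure set 'rV[R]_n -> \bar R} :=
  match n with
  | 0 => dirac (0 : 'rV[R]_0)
  | m.+1 => lebesgue_rV_succ (lebesgue_rV R m)
  end.

Section sobolev.
Context (R : realType) (N : nat).
Notation RN := 'rV[R]_N.
Notation mu := (lebesgue_rV R N).
Implicit Types (u v phi : RN -> R) (i : 'I_N).

(* The library's norm on 'rV[R]_N is the sup norm; |x| is the Euclidean one. *)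
Definition enorm (x : RN) : R := Num.sqrt (\sum_i x ord0 i ^+ 2).

Definition partial i phi : RN -> R := fun x => 'D_(delta_mx ord0 i) phi x.

Definition smooth phi : Prop :=
  forall s : seq 'I_N, let psi := foldr partial phi s in
    continuous psi /\ forall x i, derivable psi x (delta_mx ord0 i).

Definition test_function phi : Prop :=
  smooth phi /\ compact (closure [set x | phi x != 0]).

Definition is_weak_partial i u g : Prop :=
  forall phi, test_function phi ->
    \int[mu]_x (u x * partial i phi x) = - \int[mu]_x (g x * phi x).

(* Elements of H^1 are represented by Borel functions; two functions equal
   almost everywhere represent the same element. *)
Definition H1 : set (RN -> R) :=
  [set u | u \in Lfun mu 2%:E /\
     forall i, exists2 g, g \in Lfun mu 2%:E & is_weak_partial i u g].

(* A representative of the i-th weak derivative of u, meaningful for u in H1. *)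
Definition weak_partial i u : RN -> R :=
  xget (cst 0) [set g | g \in Lfun mu 2%:E /\ is_weak_partial i u g].

(* ||u||_r *)
Definition Lpnorm (r : R) u : R := fine ('N[mu]_(r%:E) [EFin \o u])%E.

(* ||grad u||_2^2 *)
Definition dirichlet u : R := \int[mu]_x (\sum_i weak_partial i u x ^+ 2).

(* Nonnegative, radially symmetric and nonincreasing in |x|, as a property of
   the class of u; the profile is not constrained at 0, so that unbounded
   functions are not excluded. *)
Definition schwarz_symmetric u : Prop :=
  exists f : R -> R,
    [/\ forall r, 0 < r -> 0 <= f r,
        forall r s, 0 < r -> r <= s -> f s <= f r
      & {ae mu, forall x, u x = f (enorm x)}].

(* u is a weak solution of - Delta u + lambda u = h in R^N. *)
Definition weak_solution (lambda : R) u (h : RN -> R) : Prop :=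
  forall phi, H1 phi ->
    \int[mu]_x (\sum_i weak_partial i u x * weak_partial i phi x) +
      lambda * \int[mu]_x (u x * phi x) = \int[mu]_x (h x * phi x).

Definition energy (p q alpha beta mu1 mu2 nu : R)
    (w : (RN -> R) * (RN -> R)) : R :=
  2^-1 * (dirichlet w.1 + dirichlet w.2)
  - mu1 / p * Lpnorm p w.1 `^ p - mu2 / q * Lpnorm q w.2 `^ q
  - nu * \int[mu]_x (`|w.1 x| `^ alpha * `|w.2 x| `^ beta).

Definition Tset (a1 b1 : R) : set ((RN -> R) * (RN -> R)) :=
  [set w | [/\ H1 w.1, H1 w.2,
               Lpnorm 2 w.1 ^+ 2 = a1 & Lpnorm 2 w.2 ^+ 2 = b1]].

Definition Aset (rho a1 b1 : R) : set ((RN -> R) * (RN -> R)) :=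
  [set w | Tset a1 b1 w /\ dirichlet w.1 + dirichlet w.2 < rho].

Definition Bset (rho a1 b1 : R) : set ((RN -> R) * (RN -> R)) :=
  [set w | Tset a1 b1 w /\ rho <= dirichlet w.1 + dirichlet w.2 <= 2 * rho].

Definition inf_energy (p q alpha beta mu1 mu2 nu : R)
    (S : set ((RN -> R) * (RN -> R))) : \bar R :=
  ereal_inf [set (energy p q alpha beta mu1 mu2 nu w)%:E | w in S].

(* m_nu(a1, b1) *)
Definition ground_level (p q alpha beta mu1 mu2 nu rho0 a1 b1 : R) : \bar R :=
  inf_energy p q alpha beta mu1 mu2 nu (Aset rho0 a1 b1).

Definition local_min_geometry (p q alpha beta mu1 mu2 a b nu0 k0 rho0 : R) :
    Prop :=
  forall a1 b1 nu : R,
    0 <= a1 <= a -> 0 <= b1 <= b -> (a1, b1) != (0, 0) -> 0 < nu < nu0 ->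
    (inf_energy p q alpha beta mu1 mu2 nu (Aset rho0 a1 b1) < 0)%E /\
    (k0%:E <= inf_energy p q alpha beta mu1 mu2 nu (Bset rho0 a1 b1))%E.

End sobolev.

(* Main.v *)
Require Import Defs.
From HB Require Import structures.
From mathcomp Require Import all_boot all_order all_algebra.
From mathcomp Require Import all_classical all_reals all_analysis.
From mathcomp Require Import measurable_realfun.
From mathcomp Require Import ring lra.

Set Implicit Arguments.
Unset Strict Implicit.
Unset Printing Implicit Defensive.

Import Order.TTheory GRing.Theory Num.Theory.
Import numFieldNormedType.Exports.

Local Open Scope classical_set_scope.
Local Open Scope ring_scope.

(** Only the equations, positivity and the Schwarz profiles are used, except in
    the exclusion of [lambda1 = lambda2 = 0], which needs [J(u0,v0) < 0].

    The product bumps [phi_r(x) = prod_i w(x_i / r)] with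
    [w(t) = exp(-1/(1+t) - 1/(1-t))] satisfy [-Delta phi_r <= (9N/r^2) phi_r].
    Hence a positive weak solution of [-Delta u + lambda u = h >= 0] satisfies
    [int h phi_r <= (9N/r^2 + lambda) int u phi_r], and letting [r] grow gives
    [lambda >= 0].  If [lambda = 0] and [u] is in [L^t] with [t > 1] and
    [N(t-1) <= 2t], Young's inequality makes [r^-2 int u phi_r] tend to [0], so
    that [int h = 0], which is absurd.  For [N <= 4] take [t = 2]; for
    [p <= (2N-2)/(N-2)] take [t = p-1], the bound on [int u^(p-1)] being itself
    a consequence of the same inequality because [h >= mu1 u^(p-1)].  Finally,
    if both multipliers vanish, testing with [u0] and [v0] expresses the
    Dirichlet energies by the nonlinear terms, and [J(u0,v0) >= 0] because
    [p, q, alpha + beta > 2].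

    No Sobolev embedding is needed: the equation tested with [u] forces [h u] to
    be integrable, and [u] is bounded below on bounded sets, so [h] is locally
    integrable. *)

(** * Smooth functions on R^n *)

Section flat.
Context {R : realType}.
Implicit Types t : R.

(** The factor [t^-1 ^+ k] closes the family under differentiation: every derivative of exp(-1/t) is
    a combination of other members, so the only delicate point is t = 0, treated once for all
    [k]. *)
Definition flat (k : nat) t : R := if 0 < t then t^-1 ^+
  k * expR (- t^-1) else 0.

Lemma flat_ge0 k t : 0 <= flat k t.
Proof.
rewrite /flat; case: ifP => // t0.
by rewrite mulr_ge0 ?expR_ge0// exprn_ge0// invr_ge0 ltW.
Qed.

Lemma flat_gt0 k t : 0 < t -> 0 < flat k t.
Proof. by move=> t0;
  rewrite /flat t0 mulr_gt0 ?expR_gt0// exprn_gt0// invr_gt0. Qed.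

Lemma flat_le0 k t : t <= 0 -> flat k t = 0.
Proof. by move=> t0; rewrite /flat ltNge t0. Qed.

Lemma flat0_le1 t : flat 0 t <= 1.
Proof.
rewrite /flat; case: ifP => // t0.
by rewrite expr0 mul1r expR_le1 oppr_le0 invr_ge0 ltW.
Qed.

(** The term of order k + 2 of the exponential series at 1/t gives the bound. The square on the
    right is what makes the difference quotients at 0 tend to 0. *)
Lemma flat_bound k t : flat k t <= k.+2`!%:R * t ^+ 2.
Proof.
rewrite /flat; case: ifP => [t0|_]; last by rewrite mulr_ge0 ?sqr_ge0.
have := @expR_ge1Dxn _ t^-1 k.+1; rewrite invr_ge0 => /(_ (ltW t0)) h.
rewrite expRN ler_pdivrMr ?expR_gt0//.
have {}h : t^-1 ^+ k.+2 / k.+2`!%:R <= expR t^-1 by apply: le_trans h;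
  rewrite lerDr.
apply: le_trans (ler_wpM2l _ h); last by rewrite mulr_ge0 ?sqr_ge0.
have f0 : k.+2`!%:R != 0 :> R by rewrite pnatr_eq0 -lt0n fact_gt0.
suff -> : k.+2`!%:R * t ^+ 2 * (t^-1 ^+ k.+2 / k.+2`!%:R) = t^-1 ^+ k by [].
by rewrite !exprS; field; rewrite f0 gt_eqF.
Qed.

Lemma is_derive_flat0 k : is_derive (0 : R) 1 (flat k) 0.
Proof.
have flat0E : flat k 0 = 0 by rewrite flat_le0.
have cv : h^-1 *: ((flat k \o shift 0) (h *: (1:R)) - flat k 0) @[h -->
  (0:R)^'] --> (0:R).
  apply/cvgr0Pnorm_le => e e0; near=> h.
  have h0 : h != 0 by near: h; exact: nbhs_dnbhs_neq.
  rewrite flat0E subr0 /= addr0 [_%:A]mulr1 normrM normrV ?unitfE//.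
  rewrite (ger0_norm (flat_ge0 _ _)) mulrC ler_pdivrMr ?normr_gt0//.
  apply: le_trans (flat_bound _ _) _;
    rewrite -real_normK ?num_real// expr2 mulrA.
  rewrite ler_wpM2r// mulrC -ler_pdivlMr ?ltr0n ?fact_gt0//.
  near: h; apply: dnbhs0_le.
  by rewrite divr_gt0// ltr0n fact_gt0.
by apply: DeriveDef; [apply/cvg_ex; exists 0|exact: cvg_lim cv].
Unshelve. all: by end_near. Qed.

Definition dflat k t := flat k.+2 t - k%:R * flat k.+1 t.

Lemma is_derive_flat k t : is_derive t 1 (flat k) (dflat k t).
Proof.
have [t0|t0|->] := ltgtP t 0; last first.
- have -> : dflat k 0 = 0 by rewrite /dflat !flat_le0// mulr0 subrr.
  exact: is_derive_flat0.
- pose inv := fun s : R => s^-1.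
  have eqf : \near t, (inv ^+ k * (expR \o - inv)) t = flat k t.
    near=> s; rewrite /flat ifT//; last by near: s; exact: lt_nbhsr.
    by rewrite /GRing.mul/= exprfctE.
  apply: (near_eq_is_derive eqf).
  have tn0 : t != 0 by rewrite gt_eqF.
  have dV : is_derive t 1 inv (- t ^- 2).
    by apply: is_derive_eq (is_deriveV tn0 (is_derive_id _ _)) _;
      rewrite [_%:A]mulr1.
  have dVk := is_deriveX k dV.
  have dE := @is_derive1_comp _ expR (- inv) t _ _ (is_derive_expR _)
    (is_deriveN dV).
  apply: is_derive_eq (is_deriveM dVk dE) _.
  rewrite exprfctE /dflat /flat t0 /= /inv /GRing.scale/= opprK.
  case: k dVk eqf => [|k] _ _; first by rewrite !expr0 /=; field.
  by rewrite /= !exprS; field.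
- have eqf : \near t, cst 0 t = flat k t.
    near=> s; rewrite flat_le0//; apply: ltW.
    by near: s; exact: lt_nbhsl.
  apply: (near_eq_is_derive eqf).
  apply: is_derive_eq (is_derive_cst _ _ _) _.
  by rewrite /dflat !flat_le0 ?ltW// mulr0 subrr.
Unshelve. all: by end_near. Qed.

End flat.

(** * A class of functions stable under partial derivatives *)

Section elementary_smooth.
Context {R : realType} {n : nat}.
Notation RN := 'rV[R]_n.
Implicit Types (f g : RN -> R) (x : RN) (i j : 'I_n).

(** A directional derivative sees only the restriction of [f] to a line; this reduces it to one real
    variable, recentred at 0. *)
Lemma is_derive_line f x (v : RN) (df : R) :
  is_derive (0 : R) 1 (fun h => f (h *: v + x)) df -> is_derive x v f df.
Proof.
move=> [d1 d2]; split; first exact/derivable1P.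
rewrite -{}d2 /derive; set g1 := fun h => h^-1 *: _;
  set g2 := fun h => h^-1 *: _.
suff -> : g1 = g2 by [].
apply/funext => h; rewrite /g1 /g2 /= addr0 scale0r add0r.
by rewrite [_%:A]mulr1.
Qed.

Lemma coord_line (h : R) i j x :
  (h *: delta_mx ord0 i + x) ord0 j = h * (j == i)%:R + x ord0 j.
Proof. by rewrite !mxE eqxx. Qed.

Lemma is_derive_affine (a b : R) (g : R -> R) (dg h0 : R) :
  is_derive (a * h0 + b) 1 g dg ->
  is_derive h0 1 (fun h : R => g (a * h + b)) (a * dg).
Proof.
move=> dg1.
have dl : is_derive h0 1 (fun h : R => a * h + b) a.
  apply: is_derive_eq (is_deriveD (is_deriveZ a (is_derive_id h0 (1 : R)))
    (is_derive_cst b h0 1)) _.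
  by rewrite addr0 [LHS]mulr1.
by rewrite mulrC; exact: (@is_derive1_comp _ g (fun h => a * h + b)).
Qed.

(** [smooth] quantifies over all iterated partial derivatives. A class that contains the building
    blocks of the bumps and is closed under [partial] turns smoothness into an induction on the list
    of directions. *)
Inductive elementary_smooth : (RN -> R) -> Prop :=
| es_flat k a b i : elementary_smooth (fun x => flat k (a * x ord0 i + b))
| es_cst c : elementary_smooth (cst c)
| es_add f g : elementary_smooth f -> elementary_smooth g ->
    elementary_smooth (f + g)
| es_mul f g : elementary_smooth f -> elementary_smooth g ->
    elementary_smooth (f * g).

Lemma elementary_smooth_partial f i : elementary_smooth f ->
  exists2 g, elementary_smooth g &
    forall x, is_derive x (delta_mx ord0 i) f (g x).
Proof.
elim=> [k a b j|c|{}f g _ [f' sf' df] _ [g' sg' dg]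
                 |{}f g sf [f' sf' df] sg [g' sg' dg]].
- exists (cst (a * (j == i)%:R) * ((fun x => flat k.+2 (a * x ord0 j + b)) +
      cst (- k%:R) * (fun x => flat k.+1 (a * x ord0 j + b)))).
    by do ?[apply: es_mul|apply: es_add]; (exact: es_cst || exact: es_flat).
  move=> x; apply: is_derive_line.
  rewrite (_ : (fun _ => _) = fun h => flat k ((a * (j == i)%:R) * h +
      (a * x ord0 j + b))); last first.
    by apply/funext => h; rewrite coord_line; congr flat; ring.
  apply: is_derive_eq.
    by apply: is_derive_affine; exact: is_derive_flat.
  by rewrite /dflat mulr0 add0r /GRing.mul/= /GRing.add/= mulNr.
- by exists (cst 0); [exact: es_cst|move=> x; exact: is_derive_cst].
- by exists (f' + g'); [exact: es_add|move=> x; exact: is_deriveD].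
- exists (f * g' + g * f'); first by apply: es_add; exact: es_mul.
  by move=> x; exact: is_deriveM.
Qed.

Lemma continuous_flat k : continuous (@flat R k).
Proof.
move=> t; apply/differentiable_continuous/derivable1_diffP.
by have [] := is_derive_flat k t.
Qed.

Lemma elementary_smooth_continuous f : elementary_smooth f -> continuous f.
Proof.
elim=> [k a b i x|c x|{}f g _ cf _ cg x|{}f g _ cf _ cg x].
- apply: (continuous_comp (f := fun x : RN => a * x ord0 i + b));
    last exact: continuous_flat.
  apply: (@continuousD _ _ _ (fun y : RN => a * y ord0 i) (cst b));
    last exact: cst_continuous.
  apply: (@continuousM _ _ (cst a) (fun y : RN => y ord0 i)).
    exact: cst_continuous.
  exact: coord_continuous.
- exact: cst_continuous.
- by apply: continuousD; [exact: cf|exact: cg].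
- by apply: continuousM; [exact: cf|exact: cg].
Qed.

Lemma elementary_smoothW f : elementary_smooth f -> smooth f.
Proof.
move=> sf s; suff sf' : elementary_smooth (foldr (@partial R n) f s).
  split; first exact: elementary_smooth_continuous.
  by move=> x i; have [g _ /(_ x)[]] := elementary_smooth_partial i sf'.
elim: s => //= i s /(elementary_smooth_partial i)[g sg dg].
suff -> : partial i (foldr (@partial R n) f s) = g by [].
by apply/funext => x; rewrite /partial; apply: derive_val.
Qed.

Lemma elementary_smooth_prod (I : Type) (r : seq I) (F : I -> RN -> R) :
  (forall k, elementary_smooth (F k)) ->
  elementary_smooth (fun x => \prod_(k <- r) F k x).
Proof.
move=> sF; elim: r => [|k r ih].
  rewrite (_ : (fun _ => _) = cst 1); first exact: es_cst.
  by apply/funext => x; rewrite big_nil.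
rewrite (_ : (fun _ => _) = F k * (fun x => \prod_(l <- r) F l x)).
  exact: es_mul.
by apply/funext => x; rewrite big_cons.
Qed.

(** The factors may differ from one coordinate to another, so that the lemma applies again to a
    product whose i-th factor has already been differentiated. *)
Lemma is_derive_tensor (w : 'I_n -> R -> R) (dw : R) i x :
  is_derive (x ord0 i) 1 (w i) dw ->
  is_derive x (delta_mx ord0 i) (fun y => \prod_j w j (y ord0 j))
    (dw * \prod_(j | j != i) w j (x ord0 j)).
Proof.
move=> dwi; apply: is_derive_line.
set c := \prod_(j | _) _.
rewrite (_ : (fun _ => _) = fun h => c *: w i (1 * h + x ord0 i)); last first.
  apply/funext => h; rewrite (bigD1 i)//= coord_line eqxx mulr1 mul1r mulrC.
  congr (_ * _); apply: eq_bigr => j ji.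
  by rewrite coord_line (negbTE ji) mulr0 add0r.
rewrite mulrC -[dw]mul1r; apply: is_deriveZ; apply: is_derive_affine.
by rewrite mulr0 add0r.
Qed.

End elementary_smooth.

(** * Boxes and Lebesgue measure on R^n *)

Section boxes.
Context {R : realType}.

Definition obox n (a b : 'I_n -> R) : set 'rV[R]_n :=
  [set x | forall i, x ord0 i \in `]a i, b i[].

Definition cube n (M : R) : set 'rV[R]_n := obox (fun=> - M) (fun=> M).

Lemma measurable_rV_prod n (A : 'I_n -> set R) : (forall i, measurable (A i)) ->
  measurable [set x : 'rV[R]_n | forall i, A i (x ord0 i)].
Proof.
move=> mA; rewrite (_ : [set _ | _] =
    \bigcap_(i in [set: 'I_n]) (@rV_coord R n i @^-1` A i)).
  apply: fin_bigcap_measurable => [|i _]; first exact: finite_finset.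
  rewrite -[X in measurable X]setTI; apply: measurable_rV_coord => //;
    exact: mA.
by apply/seteqP; split => [x Ax i _|x Ax i]; [exact: Ax|exact: (Ax i I)].
Qed.

Lemma measurable_obox n (a b : 'I_n -> R) : measurable (obox a b).
Proof. exact: (measurable_rV_prod (A := fun i => `]a i, b i[%classic)). Qed.

Lemma measurable_cube n (M : R) : measurable (@cube n M).
Proof. exact: measurable_obox. Qed.

(** Boxes, unlike preimages under single coordinates, form a generator stable under intersection
    that consists of sets of finite measure; the Dynkin argument in [fundamental_lemma] relies on
    this. *)
Lemma measurable_rV_generated_by_obox n :
  @measurable _ 'rV[R]_n = <<s [set obox ab.1 ab.2 | ab in [set: ('I_n ->
    R) * ('I_n -> R)]] >>.
Proof.
set G := [set _ | _ in _]; apply/seteqP; split; last first.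
  apply: smallest_sub; first exact: sigma_algebra_measurable.
  by move=> _ [ab _ <-]; exact: measurable_obox.
apply: smallest_sub; first exact: smallest_sigma_algebra.
rewrite -bigcup_seq => B [i _ [C mC <-]]; rewrite setTI.
pose T := g_sigma_algebraType G.
pose f : T -> R := fun x => (x : 'rV[R]_n) ord0 i.
suff mf : measurable_fun setT f by have := mf measurableT C mC; rewrite setTI.
apply: (measurability _ (RGenOpens.measurableE R)).
move=> _ [_ [c [d ->]] <-]; rewrite setTI.
(* The slab where coordinate [i] lies in ]c, d[ is exhausted by boxes whose other sides are ]-k,
   k[. *)
pose F (k : nat) : set T := obox (fun j => if j == i then c else - k%:R)
  (fun j => if j == i then d else k%:R).
rewrite (_ : _ @^-1` _ = \bigcup_k F k); last first.
  apply/seteqP; split => [x /= xcd|x [k _ /(_ i)]]; last by rewrite eqxx.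
  have [k xk] : exists k : nat, forall j, `|(x : 'rV[R]_n) ord0 j| < k%:R.
    exists (\max_j (Num.truncn `|(x : 'rV[R]_n) ord0 j|).+1) => j.
    apply: lt_le_trans (Num.Theory.truncnS_gt _) _.
    by rewrite ler_nat (@leq_bigmax _ (fun j => (Num.truncn `|(x :
      'rV[R]_n) ord0 j|).+1) j).
  exists k => // j /=; case: eqP => [->//|_].
  by rewrite in_itv/= -ltr_norml.
apply: bigcupT_measurable => k; apply: sub_sigma_algebra.
by exists (fun j => if j == i then c else - k%:R, fun j => if j ==
  i then d else k%:R).
Qed.

(** An open set is the union of the boxes with rational centre and radius 1/(k+1) that it contains,
    and these are countably many. A box that sticks out is replaced by the empty set. *)
Lemma open_measurable_rV n (U : set 'rV[R]_n) : open U -> measurable U.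
Proof.
move=> oU.
pose F (ck : 'rV[rat]_n * nat) : set 'rV[R]_n :=
  obox (fun i => ratr (ck.1 ord0 i) - ck.2.+1%:R^-1)
       (fun i => ratr (ck.1 ord0 i) + ck.2.+1%:R^-1).
pose G ck := if `[<F ck `<=` U>] then F ck else set0.
rewrite (_ : U = \bigcup_ck G ck); last first.
  apply/seteqP; split => [x Ux|x [ck _]]; last first.
    by rewrite /G; case: ifPn => // /asboolP; exact.
  have [e e0 xeU] : exists2 e : R, 0 < e & ball x e `<=` U.
    by have /nbhs_ballP[e e0 ?] := open_nbhs_nbhs (conj oU Ux); exists e.
  (* The rational centre will be within 1/(k+1) of [x], so the box stays within 2/(k+1) < e of [x].
     Balls of the sup norm are cubes. *)
  have [k ke] : exists k : nat, k.+1%:R^-1 < e / 2.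
    exists (Num.truncn (e / 2)^-1); rewrite invf_plt ?posrE ?divr_gt0//.
    exact: Num.Theory.truncnS_gt.
  have k0 : 0 < k.+1%:R^-1 :> R by rewrite invr_gt0.
  have /choice[c xc] : forall i : 'I_n, exists q : rat,
      ratr q \in `](x ord0 i - k.+1%:R^-1), (x ord0 i + k.+1%:R^-1)[.
    move=> i; have [|q xq] := @rat_in_itvoo R (x ord0 i - k.+1%:R^-1) (x ord0 i
      + k.+1%:R^-1).
      by rewrite ltrD2l (lt_trans _ k0)// oppr_lt0.
    by exists q.
  exists (\row_i c i, k) => //; rewrite /G ifT.
    move=> i /=; rewrite mxE in_itv/=; have := xc i; rewrite in_itv/=.
    by move: (k.+1%:R^-1) (ratr _) (x ord0 i) => d q xi /andP[? ?]; apply/andP;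
      split; lra.
  apply/asboolP => y /= yF; apply: xeU; split=> // i j; rewrite ord1 /ball/=.
  have := yF j; have := xc j; rewrite mxE !in_itv/= ltr_norml; move: ke.
  move: (k.+1%:R^-1) (ratr (c j)) (y ord0 j) (x ord0 j) => d q yj xj.
  by move=> ? /andP[? ?] /andP[? ?]; apply/andP; split; lra.
apply: countable_bigcupT_measurable => [|ck]; first exact: countableP.
by rewrite /G; case: ifP => // _; exact: measurable_obox.
Qed.

Lemma continuous_measurable_rV n (f : 'rV[R]_n -> R) :
  continuous f -> measurable_fun setT f.
Proof.
move=> cf; apply: (measurability _ (RGenOpens.measurableE R)).
move=> _ [_ [a [b ->]] <-]; rewrite setTI; apply: open_measurable_rV.
move/continuousP : cf; apply; exact: interval_open.
Qed.

Lemma rV_cons0 n (t : R) (y : 'rV[R]_n) : rV_cons (t, y) ord0 ord0 = t.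
Proof.
rewrite /rV_cons/= (_ : ord0 = lshift n (ord0 : 'I_1)); last exact: val_inj.
by rewrite [LHS](@row_mxEl _ 1 1 n) mxE.
Qed.

Lemma rV_consS n (t : R) (y : 'rV[R]_n) i :
  rV_cons (t, y) ord0 (lift ord0 i) = y ord0 i.
Proof.
rewrite /rV_cons/= (_ : lift ord0 i = rshift 1 i); last exact: val_inj.
exact: (@row_mxEr _ 1 1 n).
Qed.

Lemma lebesgue_rV_prod n (A : 'I_n -> set R) : (forall i, measurable (A i)) ->
  lebesgue_rV R n [set x | forall i, A i (x ord0 i)] =
  (\prod_i lebesgue_measure (A i))%E.
Proof.
elim: n A => [|n ih] A mA.
  rewrite big_ord0 /= diracE mem_set//; by case.
rewrite big_ord_recl -(ih (fun i => A (lift ord0 i)))//=.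
rewrite /lebesgue_rV_succ /pushforward.
rewrite (_ : _ @^-1` _ = A ord0 `*`
    [set x : 'rV[R]_n | forall i, A (lift ord0 i) (x ord0 i)]); last first.
  apply/seteqP; split => [[t y]/= tyA|[t y]/= [At Ay] i].
    by split => [|i]; [rewrite -(rV_cons0 t y)|rewrite -(rV_consS t)].
  have [j ->|->] := unliftP ord0 i; by rewrite ?rV_consS ?rV_cons0.
rewrite product_measure1E//; first exact: mA.
by apply: (@measurable_rV_prod n (fun i => A (lift ord0 i))) => i; exact: mA.
Qed.

Lemma lebesgue_rV_obox n (a b : 'I_n -> R) : (forall i, a i < b i) ->
  lebesgue_rV R n (obox a b) = (\prod_i (b i - a i))%:E.
Proof.
move=> ab; rewrite (lebesgue_rV_prod (A := fun i => `]a i, b i[%classic))//.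
rewrite -prodEFin; apply: eq_bigr => i _.
by rewrite lebesgue_measure_itv/= lte_fin ab.
Qed.

Lemma lebesgue_rV_cube n (M : R) : 0 < M ->
  lebesgue_rV R n (@cube n M) = ((2 * M) ^+ n)%:E.
Proof.
move=> M0; rewrite lebesgue_rV_obox => [|_]; last by rewrite gtrN.
by rewrite prodr_const card_ord opprK -mulr2n mulr_natl.
Qed.

End boxes.

(** * Integration by parts *)

Section integral_partial.
Context {R : realType}.

(** Only the values along the two lines matter, and the ambient spaces may differ. This transports
    derivatives from R^(n+1) to slices with a frozen coordinate. *)
Lemma is_derive_congr (V W : normedModType R) (f : V -> R) (g : W -> R)
    (x v : V) (y w : W) (df : R) :
  (forall h : R, f (h *: v + x) = g (h *: w + y)) ->
  is_derive x v f df -> is_derive y w g df.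
Proof.
move=> fg; have fg0 : f x = g y by have := fg 0; rewrite !scale0r !add0r.
have E : (fun h : R => h^-1 *: ((f \o shift x) (h *: v) - f x)) =
         (fun h : R => h^-1 *: ((g \o shift y) (h *: w) - g y)).
  by apply/funext => h /=; rewrite fg fg0.
by move=> [+ <-]; rewrite /derivable /derive E => dg; split.
Qed.

Lemma integrable_bounded_support d (T : measurableType d)
    (mu : {measure set T -> \bar R}) (A : set T) (f : T -> R) (C : R) :
  measurable A -> (mu A < +oo)%E -> measurable_fun setT f ->
  (forall x, A x -> `|f x| <= C) -> (forall x, ~ A x -> f x = 0) ->
  mu.-integrable setT (EFin \o f).
Proof.
move=> mA Aoo mf fC f0.
rewrite (_ : EFin \o f = (EFin \o f) \_ A).
  apply/(integrable_mkcond _ mA)/measurable_bounded_integrable => //.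
    exact: measurable_funS mf.
  exists C; split; first exact: num_real.
  by move=> M CM x /= Ax; rewrite (le_trans (fC _ Ax))// ltW.
apply/funext => x; rewrite patchE; case: ifPn => //.
by rewrite notin_setE => /f0 /= ->.
Qed.

Lemma cube_le n (M K : R) : M <= K -> @cube R n M `<=` cube K.
Proof.
move=> MK x Mx i; have := Mx i; rewrite !in_itv/= => /andP[xM Mx'].
by rewrite (le_lt_trans _ xM) ?lerN2// (lt_le_trans Mx').
Qed.

Lemma compact_sub_cube n (K : set 'rV[R]_n) : compact K ->
  exists2 M, 0 < M & K `<=` cube M.
Proof.
(* [compact_bounded] gives a large inequality for each number above [M], here |M| + 1; one more unit
   makes it strict, since the cube is open. *)
move=> /compact_bounded[M [_ KM]]; exists (`|M| + 2); first by rewrite ltr_wpDl.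
move=> x Kx i; have /KM/(_ x Kx) xM : M < `|M| + 1.
  by rewrite (le_lt_trans (ler_norm M))// ltrDl.
rewrite in_itv/= -ltr_norml (@le_lt_trans _ _ (`|M| + 1))//;
  last by rewrite ltrD2l ltrDl.
apply: le_trans xM;
  have /mapP[j Hj ->] : `|x ord0 i| \in [seq `|x j.1 j.2| | j : 'I_1 * 'I_n].
  by apply/mapP; exists (ord0, i) => //=; rewrite mem_enum.
by rewrite [leRHS]/Num.norm/= mx_normrE; apply/bigmax_geP; right => /=;
  exists j.
Qed.

Lemma continuous_cube_bounded n (f : 'rV[R]_n -> R) (M : R) : continuous f ->
  exists2 C, 0 <= C & forall x, cube M x -> `|f x| <= C.
Proof.
move=> cf; have cK : compact [set x : 'rV[R]_n | forall i, `[- M,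
  M]%classic (x ord0 i)].
  by apply: (@rV_compact _ _ (fun=> `[- M, M]%classic)) => _;
    exact: segment_compact.
have /compact_bounded[C [_ fC]] : compact (f @` [set x : 'rV[R]_n | forall i,
  `[- M, M]%classic (x ord0 i)]).
  by apply: continuous_compact => //; exact: continuous_subspaceT.
exists (`|C| + 1) => [|x Mx]; first by rewrite addr_ge0.
apply: (fC (`|C| + 1)); first by rewrite (le_lt_trans (ler_norm C))// ltrDl.
exists x => // i; have := Mx i; rewrite /= !in_itv/= => /andP[? ?].
by rewrite !ltW.
Qed.

Lemma lebesgue_rV_cube_lty n (M : R) : (lebesgue_rV R n (cube M) < +oo)%E.
Proof.
have [M0|M0] := ltP 0 M; first by rewrite lebesgue_rV_cube// ltry.
apply: (@le_lt_trans _ _ (lebesgue_rV R n (cube 1))).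
  by apply: le_measure; rewrite ?inE; [exact: measurable_cube..|apply: cube_le;
    lra].
by rewrite lebesgue_rV_cube// ltry.
Qed.

Lemma integrable_cube n (f : 'rV[R]_n -> R) (M : R) : continuous f ->
  (forall x, ~ cube M x -> f x = 0) ->
  (lebesgue_rV R n).-integrable setT (EFin \o f).
Proof.
move=> cf f0; have [C _ fC] := continuous_cube_bounded M cf.
apply: (@integrable_bounded_support _ _ _ (cube M) _ C) => //.
- exact: measurable_cube.
- exact: lebesgue_rV_cube_lty.
- exact: continuous_measurable_rV.
Qed.

Lemma rV_cons_line n (t h : R) (y : 'rV[R]_n) i :
  rV_cons (t, h *: delta_mx ord0 i + y) =
  h *: delta_mx ord0 (lift ord0 i) + rV_cons (t, y).
Proof.
apply/rowP => j; have [k ->|->] := unliftP ord0 j.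
  by rewrite coord_line !rV_consS coord_line (inj_eq lift_inj).
by rewrite coord_line !rV_cons0 mulr0 add0r.
Qed.

Lemma rV_cons_line0 n (t h : R) (y : 'rV[R]_n) :
  rV_cons (h + t, y) = h *: delta_mx ord0 ord0 + rV_cons (t, y).
Proof.
apply/rowP => j; have [k ->|->] := unliftP ord0 j.
  by rewrite coord_line !rV_consS mulr0 add0r.
by rewrite coord_line !rV_cons0 mulr1.
Qed.

Lemma continuous_rV_cons n (f : 'rV[R]_n.+1 -> R) : continuous f ->
  (forall t, continuous (fun y => f (rV_cons (t, y)))) /\
  (forall y, continuous (fun t : R => f (rV_cons (t, y)))).
Proof.
move=> cf; split=> [t y|y t].
- apply: (continuous_comp (f := fun y => rV_cons (t, y))); last exact: cf.
  move=> A /nbhs_ballP[e /= e0 eA]; apply/nbhs_ballP; exists e => // z yz;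
    apply: eA.
  split => // i j; rewrite (ord1 i); have [k ->|->] := unliftP ord0 j.
    by rewrite !rV_consS; have [_] := yz; exact.
  by rewrite !rV_cons0; exact: ballxx.
- apply: (continuous_comp (f := fun t : R => rV_cons (t, y))); last exact: cf.
  move=> A /nbhs_ballP[e /= e0 eA]; apply/nbhs_ballP; exists e => // z tz;
    apply: eA.
  split => // i j; rewrite (ord1 i); have [k ->|->] := unliftP ord0 j.
    by rewrite !rV_consS; exact: ballxx.
  by rewrite !rV_cons0.
Qed.

(** The fundamental theorem of calculus on [-M, M]: [f] vanishes at both endpoints, which lie
    outside the open interval. *)
Lemma integral_derivative_eq0 (f df : R -> R) (M : R) : 0 < M ->
  continuous df -> (forall t : R, is_derive t 1 f (df t)) ->
  (forall t, ~ t \in `]- M, M[ -> f t = 0) ->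
  (forall t, ~ t \in `]- M, M[ -> df t = 0) ->
  (\int[lebesgue_measure]_t (df t)%:E = 0)%E.
Proof.
move=> M0 cdf fdf f0 df0.
have cf : continuous f.
  move=> t; apply/differentiable_continuous/derivable1_diffP.
  by have [] := fdf t.
rewrite (_ : (fun t => (df t)%:E) = (EFin \o df) \_ `[- M, M]).
  rewrite -integral_mkcond (@continuous_FTC2 _ _ f).
  - rewrite !f0 ?subee// in_itv/= ?ltxx ?andbF//.
  - by rewrite gtrN.
  - exact: continuous_subspaceT.
  - split; first by move=> t _; have [] := fdf t.
    + exact/cvg_at_right_filter/cf.
    + exact/cvg_at_left_filter/cf.
  - by move=> t _; rewrite derive1E; have [_ ->] := fdf t.
apply/funext => t; rewrite patchE; case: ifPn => //.
rewrite notin_setE => tM /=; rewrite df0// => tM'; apply: tM.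
by rewrite /=; apply: subset_itv_oo_cc tM'.
Qed.

(** Fubini and induction on the dimension. For a derivative in the first coordinate, that coordinate
    is integrated first by the one-dimensional case; otherwise it is frozen and the induction
    hypothesis is applied to the slice. *)
Lemma integral_partial_eq0 n (f df : 'rV[R]_n -> R) (i : 'I_n) (M : R) :
  0 < M -> continuous f -> continuous df ->
  (forall x, is_derive x (delta_mx ord0 i) f (df x)) ->
  (forall x, ~ cube M x -> f x = 0) -> (forall x, ~ cube M x -> df x = 0) ->
  (\int[lebesgue_rV R n]_x (df x)%:E = 0)%E.
Proof.
move=> M0; elim: n f df i => [f df []//|n ih f df i cf cdf fdf f0 df0].
pose mu := (@lebesgue_measure R \x lebesgue_rV R n)%E.
have cubeP t y : cube M (rV_cons (t, y)) <-> (t \in `]- M, M[) /\ @cube R n M y.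
  split=> [c|[tM yM] j].
    by split=> [|j]; [rewrite -(rV_cons0 t y)|rewrite -(rV_consS t)]; exact: c.
  have [k ->|->] := unliftP ord0 j; first by rewrite rV_consS.
  by rewrite rV_cons0.
have mdf := continuous_measurable_rV cdf.
have idf : mu.-integrable setT (EFin \o df \o @rV_cons R n).
  have [C _ dfC] := continuous_cube_bounded M cdf.
  apply: (@integrable_bounded_support _ _ mu (@rV_cons R n @^-1` cube M) _ C).
  - rewrite -[X in measurable X]setTI; apply: measurable_rV_cons => //.
    exact: measurable_cube.
  - exact: (@lebesgue_rV_cube_lty n.+1 M).
  - exact: measurableT_comp (@measurable_rV_cons R n).
  - by move=> x /dfC.
  - by move=> x /df0.
have -> : (\int[lebesgue_rV R n.+1]_x (df x)%:E =
    \int[mu]_z (EFin \o df \o @rV_cons R n) z)%E.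
  apply: (integral_pushforward (@measurable_rV_cons R n) (D := setT)) => //.
  exact/measurable_EFinP.
have [ccy cct] := continuous_rV_cons cf;
  have [cdy cdt] := continuous_rV_cons cdf.
have [j ij|i0] := unliftP ord0 i.
  rewrite -integral12_prod_meas1//; apply: integral0_eq => t _.
  apply: (ih (fun y => f (rV_cons (t, y))) (fun y => df (rV_cons (t, y))) j) =>
    //.
  - move=> y; apply: is_derive_congr (fdf (rV_cons (t, y))) => h.
    by rewrite rV_cons_line ij.
  - by move=> y yM; apply: f0; rewrite cubeP => -[].
  - by move=> y yM; apply: df0; rewrite cubeP => -[].
rewrite -integral21_prod_meas1//; apply: integral0_eq => y _.
apply: (@integral_derivative_eq0 (fun t => f (rV_cons (t, y))) _ M) => //.
- move=> t; apply: is_derive_congr (fdf (rV_cons (t, y))) => h.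
  by rewrite i0 -rV_cons_line0 [h%:A]mulr1.
- by move=> t tM; apply: f0; rewrite cubeP => -[].
- by move=> t tM; apply: df0; rewrite cubeP => -[].
Qed.

End integral_partial.

(** * Test functions belong to H^1 *)

Section test_functions.
Context {R : realType} {n : nat}.
Notation RN := 'rV[R]_n.
Notation mu := (lebesgue_rV R n).
Implicit Types (u v phi psi : RN -> R) (i : 'I_n).

Lemma test_continuous phi : test_function phi -> continuous phi.
Proof. by move=> [/(_ [::])[]]. Qed.

Lemma test_is_derive phi i x : test_function phi ->
  is_derive x (delta_mx ord0 i) phi (partial i phi x).
Proof. by move=> [/(_ [::])[_ /(_ x i) dphi] _]; exact: derivableP. Qed.

(** Off the closed support [phi] vanishes on a whole neighbourhood, hence so do its derivatives. *)
Lemma partial_support phi i : test_function phi ->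
  [set x | partial i phi x != 0] `<=` closure [set x | phi x != 0].
Proof.
move=> tphi x /=; apply: contra_neqP => xphi.
have phi0 : \near x, cst 0 x = phi x.
  have : nbhs x (~` closure [set x | phi x != 0]).
    by apply: open_nbhs_nbhs; split => //; exact/closed_openC/closed_closure.
  apply: (@filterS _ (nbhs x)) => y /= yphi; apply/esym/eqP.
  by apply: contra_notT yphi => phiy; exact: subset_closure.
by have [_] := near_eq_is_derive phi0 (is_derive_cst (0 :
  R) x (delta_mx ord0 i)).
Qed.

Lemma test_partial phi i : test_function phi -> test_function (partial i phi).
Proof.
move=> tphi; have [sphi cphi] := tphi; split=> [s|].
  by have := sphi (rcons s i); rewrite foldr_rcons.
apply: (subclosed_compact (@closed_closure _ _) cphi).
rewrite [X in _ `<=` X](proj1 (closure_id _) (@closed_closure _ _)).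
exact/closure_subset/partial_support.
Qed.

Lemma test_support phi : test_function phi ->
  exists2 M, 0 < M & forall x, ~ cube M x ->
    phi x = 0 /\ forall i, partial i phi x = 0.
Proof.
move=> tphi; have [_ /compact_sub_cube[M M0 phiM]] := tphi; exists M => // x xM.
split=> [|i]; apply/eqP; apply: contra_notT xM => phix; apply: phiM.
  exact: subset_closure.
exact: partial_support phix.
Qed.

Lemma smooth_cube_test phi (M : R) : smooth phi ->
  (forall x, ~ cube M x -> phi x = 0) -> test_function phi.
Proof.
move=> sphi phi0; split=> //.
have cK : compact [set x : RN | forall i, `[- M, M]%classic (x ord0 i)].
  by apply: (@rV_compact _ _ (fun=> `[- M, M]%classic)) => _;
    exact: segment_compact.
have clK : closed [set x : RN | forall i, `[- M, M]%classic (x ord0 i)].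
  exact: compact_closed (@norm_hausdorff _ _) cK.
apply: (subclosed_compact (@closed_closure _ _) cK).
rewrite [X in _ `<=` X](proj1 (closure_id _) clK);
  apply: closure_subset => x /= phix i.
have : cube M x by apply: contrapT => /phi0; exact/eqP.
by move=> /(_ i) xM; exact: subset_itv_oo_cc xM.
Qed.

Lemma Lfun2P u : measurable_fun setT u ->
  mu.-integrable setT (EFin \o (fun x => u x ^+ 2)) -> u \in Lfun mu 2%:E.
Proof.
move=> mu_ iu; rewrite inE; apply/andP; split; rewrite inE//=.
rewrite /finite_norm unlock; apply: poweR_lty.
have /integrableP[_] := iu; apply: le_lt_trans.
rewrite le_eqVlt; apply/orP; left; apply/eqP; apply: eq_integral => x _ /=.
by rewrite normrX -powR_mulrn.
Qed.

Lemma test_Lfun2 phi : test_function phi -> phi \in Lfun mu 2%:E.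
Proof.
move=> tphi; have cphi := test_continuous tphi.
have [M _ phi0] := test_support tphi.
apply: Lfun2P; first exact: continuous_measurable_rV.
apply: (@integrable_cube _ _ (fun x => phi x ^+ 2) M) => [x|x /phi0[-> _]].
  apply: (continuous_comp (g := fun t : R => t ^+ 2)); first exact: cphi.
  exact: exprn_continuous.
by rewrite expr0n.
Qed.

Lemma Lfun2_measurable u : u \in Lfun mu 2%:E -> measurable_fun setT u.
Proof. by rewrite inE => /andP[]; rewrite inE. Qed.

Lemma Lfun2_mul_integrable u v : u \in Lfun mu 2%:E -> v \in Lfun mu 2%:E ->
  mu.-integrable setT (EFin \o (fun x => u x * v x)).
Proof.
by move=> u2 v2; have /Lfun1_integrable := Lfun2_mul_Lfun1 u2 v2.
Qed.

(** By the product rule the two integrands add up to a partial derivative of the compactly supported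
    function phi psi, whose integral is 0. *)
Lemma test_weak_partial phi i : test_function phi ->
  is_weak_partial i phi (partial i phi).
Proof.
move=> tphi psi tpsi; apply/eqP; rewrite -addr_eq0; apply/eqP.
have tdphi := test_partial i tphi; have tdpsi := test_partial i tpsi.
have i1 := Lfun2_mul_integrable (test_Lfun2 tphi) (test_Lfun2 tdpsi).
have i2 := Lfun2_mul_integrable (test_Lfun2 tdphi) (test_Lfun2 tpsi).
rewrite -RintegralD//.
have [M M0 phi0] := test_support tphi.
rewrite /Rintegral.
have -> : (fun x => (phi x * partial i psi x + partial i phi x * psi x)%:E) = 
  (fun x => ((phi * partial i psi + psi * partial i phi) x)%:E).
  by apply/funext => x; rewrite [partial i phi x * _]mulrC.
set F := phi * partial i psi + _.
suff -> : (\int[mu]_x (F x)%:E = 0)%E by [].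
apply: (@integral_partial_eq0 _ _ (phi * psi) _ i M) => //.
- by move=> x; apply: continuousM; exact: test_continuous.
- by move=> x; apply: continuousD; apply: continuousM; exact: test_continuous.
- by move=> x; apply: is_deriveM; exact: test_is_derive.
- by move=> x /phi0[phix _]; rewrite /GRing.mul/= phix mul0r.
- move=> x /phi0[phix dphix].
  by rewrite /F /GRing.add/= /GRing.mul/= phix dphix mul0r mulr0 addr0.
Qed.

Lemma test_H1 phi : test_function phi -> H1 phi.
Proof.
move=> tphi; split; first exact: test_Lfun2.
move=> i; exists (partial i phi); last exact: test_weak_partial.
exact/test_Lfun2/test_partial.
Qed.

End test_functions.

(** * Bump functions and the fundamental lemma *)

Section bumps.
Context {R : realType}.

(** On ]a, b[ this is exp(-1/(k(t-a)) - 1/(k(b-t))). Letting [k] grow gives the indicator of the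
    interval, as used in [fundamental_lemma]; taking k = 1/r on ]-r, r[ gives the rescaled profile
    w(t/r). *)
Definition bump1 (k a b t : R) : R :=
  flat 0 (k * t - k * a) * flat 0 (- k * t + k * b).

Lemma bump1_ge0 k a b t : 0 <= bump1 k a b t.
Proof. by rewrite mulr_ge0 ?flat_ge0. Qed.

Lemma bump1_le1 k a b t : bump1 k a b t <= 1.
Proof. by rewrite mulr_ile1 ?flat_ge0 ?flat0_le1. Qed.

Lemma bump1_gt0 k a b t : 0 < k -> t \in `]a, b[ -> 0 < bump1 k a b t.
Proof.
move=> k0; rewrite in_itv/= => /andP[at_ tb]; rewrite mulr_gt0// flat_gt0//.
  by rewrite -mulrBr mulr_gt0// subr_gt0.
by rewrite mulNr addrC -mulrBr mulr_gt0// subr_gt0.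
Qed.

Lemma bump1_eq0 k a b t : 0 < k -> ~ t \in `]a, b[ -> bump1 k a b t = 0.
Proof.
move=> k0; rewrite in_itv/= => /negP; rewrite negb_and -!leNgt => /orP[ta|bt].
  by rewrite /bump1 flat_le0 ?mul0r// -mulrBr pmulr_rle0// subr_le0.
by rewrite /bump1 [X in _ * X]flat_le0 ?mulr0// mulNr addrC -mulrBr
  pmulr_rle0// subr_le0.
Qed.

Lemma cvg_bump1 a b t : t \in `]a, b[ -> bump1 n.+1%:R a b t @[n --> \oo] -->
  (1 : R).
Proof.
rewrite in_itv/= => /andP[at_ tb].
have cv (s : R) : 0 < s -> flat 0 (n.+1%:R * s) @[n --> \oo] --> (1 : R).
  move=> s0; rewrite [X in X @ _ --> _](_ : _ = fun n =>
    expR (- (s^-1 * n.+1%:R^-1))).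
    rewrite [X in _ --> X](_ : 1 = expR (- (s^-1 * 0))); last first.
      by rewrite mulr0 oppr0 expR0.
    apply: continuous_cvg; first exact: continuous_expR.
    by apply: cvgN; apply: cvgM; [exact: cvg_cst|exact: cvg_harmonic].
  apply/funext => n; rewrite /flat mulr_gt0// expr0 mul1r invfM.
  by rewrite [_^-1 * _]mulrC.
rewrite -[X in _ --> X]mulr1; apply: cvgM.
  under eq_fun do rewrite -mulrBr.
  by apply: cv; rewrite subr_gt0.
under eq_fun do rewrite mulNr addrC -mulrBr.
by apply: cv; rewrite subr_gt0.
Qed.

Context {n : nat}.
Notation RN := 'rV[R]_n.
Notation mu := (lebesgue_rV R n).
Implicit Types (a b : 'I_n -> R) (x : RN).

Definition bump k a b : RN -> R := fun x =>
  \prod_i bump1 k (a i) (b i) (x ord0 i).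

Lemma bump_ge0 k a b x : 0 <= bump k a b x.
Proof. by apply: prodr_ge0 => i _; exact: bump1_ge0. Qed.

Lemma bump_le1 k a b x : bump k a b x <= 1.
Proof. by apply: prodr_ile1 => i _; rewrite bump1_ge0 bump1_le1. Qed.

Lemma bump_gt0 k a b x : 0 < k -> obox a b x -> 0 < bump k a b x.
Proof. by move=> k0 abx; apply: prodr_gt0 => i _; exact: bump1_gt0. Qed.

Lemma bump_eq0 k a b x : 0 < k -> ~ obox a b x -> bump k a b x = 0.
Proof.
move=> k0 /existsNP[i xi]; rewrite /bump (bigD1 i)//=.
by rewrite bump1_eq0 ?mul0r.
Qed.

Lemma cvg_bump a b x : obox a b x -> bump m.+1%:R a b x @[m --> \oo] --> (1 :
  R).
Proof.
move=> abx.
suff cv s : (fun m => \prod_(i <- s) bump1 m.+1%:R (a i) (b i) (x ord0 i)) @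
  \oo --> (1 : R).
  exact: cv.
elim: s => [|i s ih].
  rewrite (_ : (fun _ => _) = fun=> 1); first exact: cvg_cst.
  by apply/funext => m; rewrite big_nil.
rewrite (_ : (fun _ => _) = (fun m => bump1 m.+1%:R (a i) (b i) (x ord0 i) *
    \prod_(j <- s) bump1 m.+1%:R (a j) (b j) (x ord0 j))); last first.
  by apply/funext => m; rewrite big_cons.
by rewrite -[X in _ --> X]mulr1; apply: cvgM => //; exact: cvg_bump1.
Qed.

Lemma obox_sub_cube a b : exists M : R, obox a b `<=` cube M.
Proof.
exists (\sum_i (`|a i| + `|b i|)) => x abx i.
have := abx i; rewrite !in_itv/= => /andP[ax xb].
have ab : `|a i| + `|b i| <= \sum_i (`|a i| + `|b i|).
  by rewrite (bigD1 i)//= lerDl sumr_ge0// => j _; rewrite addr_ge0.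
have := ler_norm (b i); have := ler_norm (- a i); rewrite normrN.
have := normr_ge0 (a i); have := normr_ge0 (b i).
move: ab ax xb; move: (\sum_i _) `|a i| `|b i| (a i) (b i) (x ord0 i).
by move=> S p q c d t *; apply/andP; split; lra.
Qed.

Lemma oboxI a b c d : obox a b `&` obox c d =
  obox (fun i => Num.max (a i) (c i)) (fun i => Num.min (b i) (d i)).
Proof.
apply/seteqP; split=> [x [xab xcd] i|x xabcd].
  have := xab i; have := xcd i; rewrite !in_itv/= gt_max lt_min.
  by move=> /andP[-> ->] /andP[-> ->].
by split=> i; have := xabcd i; rewrite !in_itv/= gt_max lt_min =>
  /andP[/andP[? ?] /andP[? ?]]; apply/andP.
Qed.

Lemma bump_test k a b : 0 < k -> test_function (bump k a b).
Proof.
move=> k0; have [M abM] := obox_sub_cube a b.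
apply: (@smooth_cube_test _ _ _ M) => [|x xM]; last first.
  by apply: bump_eq0 => // /abM.
apply: elementary_smoothW; apply: elementary_smooth_prod => i.
by apply: es_mul; exact: es_flat.
Qed.

Lemma obox_lty a b : (mu (obox a b) < +oo)%E.
Proof.
have [M abM] := obox_sub_cube a b.
apply: le_lt_trans (lebesgue_rV_cube_lty n M).
by apply: le_measure; rewrite ?inE//;
  [exact: measurable_obox|exact: measurable_cube].
Qed.

Lemma Lfun2_indic (A : set RN) : measurable A -> (mu A < +oo)%E ->
  \1_A \in Lfun mu 2%:E.
Proof.
move=> mA Aoo; apply: Lfun2P => //.
apply: (@integrable_bounded_support _ _ _ _ A _ 1) => // [|x Ax|x].
- exact: measurable_funX.
- by rewrite indicE mem_set// expr1n normr1.
- by move=> Ax; rewrite indicE memNset// expr0n.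
Qed.

Lemma Lfun2_integrable (A : set RN) (r : RN -> R) : measurable A ->
  (mu A < +oo)%E -> r \in Lfun mu 2%:E -> mu.-integrable A (EFin \o r).
Proof.
move=> mA Aoo r2; have := Lfun2_mul_integrable r2 (Lfun2_indic mA Aoo).
rewrite (_ : EFin \o _ = (EFin \o r) \_ A); last first.
  apply/funext => x; rewrite patchE/= indicE; case: ifPn => xA.
    by rewrite mulr1.
  by rewrite mulr0.
by move=> ?; apply/(integrable_mkcond _ mA).
Qed.

(** The integral of [r] is shown to vanish over boxes, then over all Borel subsets of a cube, so
    that [r] vanishes almost everywhere in each cube. *)
Lemma fundamental_lemma (r : RN -> R) : r \in Lfun mu 2%:E ->
  (forall psi, test_function psi -> \int[mu]_x (r x * psi x) = 0) ->
  {ae mu, forall x, r x = 0}.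
Proof.
move=> r2 r0; have mr := Lfun2_measurable r2.
(* The bumps of the box are at most 1 and tend to its indicator, so dominated convergence replaces
   test functions by the indicator. *)
have box0 a b : (\int[mu]_(x in obox a b) (r x)%:E = 0)%E.
  pose f_ m x := (r x * bump m.+1%:R a b x)%:E.
  have tb m : test_function (bump m.+1%:R a b) by apply: bump_test.
  have f_0 m : (\int[mu]_x f_ m x = 0)%E.
    have ib := Lfun2_mul_integrable r2 (test_Lfun2 (tb m)).
    have fin : (\int[mu]_x f_ m x)%E \is a fin_num by exact:
      (integrable_fin_num measurableT ib).
    by rewrite -(fineK fin); congr EFin; exact: r0.
  have ir : mu.-integrable setT ((EFin \o r) \_ (obox a b)).
    apply/(integrable_mkcond _ (measurable_obox a b)).
    by apply: Lfun2_integrable => //; [exact: measurable_obox|exact: obox_lty].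
  have [||||| _ _] := @dominated_convergence _ _ _ mu setT measurableT f_
    ((EFin \o r) \_ (obox a b)) (abse \o ((EFin \o r) \_ (obox a b))).
  - move=> m; apply/measurable_EFinP; apply: measurable_funM => //.
    exact: Lfun2_measurable (test_Lfun2 (tb m)).
  - exact: measurable_int ir.
  - apply: aeW => x _; rewrite patchE; case: ifPn => [/set_mem abx|].
      apply: cvg_EFin; first exact: nearW.
      rewrite -[X in _ --> X]mulr1; apply: cvgM; first exact: cvg_cst.
      exact: cvg_bump.
    rewrite notin_setE => abx; rewrite (_ : f_ ^~ x = cst 0%E);
      first exact: cvg_cst.
    by apply/funext => m; rewrite /f_ bump_eq0 ?mulr0.
  - exact: integrable_abse.
  - apply: aeW => x m _; rewrite /f_ /= patchE; case: ifPn => [_|].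
      rewrite lee_fin normrM ler_piMr// ger0_norm ?bump_ge0//.
      exact: bump_le1.
    by rewrite notin_setE => abx; rewrite bump_eq0// mulr0 normr0 abse_ge0.
  move=> cvf.
  have E : [sequence \int[mu]_x f_ m x]_m%E = cst 0%E.
    by apply/funext => m; exact: f_0.
  rewrite E in cvf; have h := cvg_lim (@ereal_hausdorff R) cvf.
  by rewrite integral_mkcond -h; exact: lim_cst.
(* A function in L^2 is integrable on sets of finite measure, hence the intersection with a cube.
   Dynkin's theorem passes from boxes to the sigma-algebra they generate. *)
have cubeE k E : measurable E -> (\int[mu]_(x in cube k%:R `&` E) (r x)%:E =
  0)%E.
  have ir B : measurable B -> mu.-integrable (cube k%:R `&` B) (EFin \o r).
    move=> mB; apply: Lfun2_integrable => //.
      by apply: measurableI => //; exact: measurable_cube.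
    apply: le_lt_trans (lebesgue_rV_cube_lty n k%:R).
    apply: le_measure; rewrite ?inE//; [|exact: measurable_cube].
    by apply: measurableI => //; exact: measurable_cube.
  move: E; rewrite measurable_rV_generated_by_obox.
  apply: dynkin_induction.
  - exact: measurable_rV_generated_by_obox.
  - by move=> _ _ [[a b] _ <-] [[c d] _ <-]; rewrite /= oboxI;
      exists (fun i => Num.max (a i) (c i), fun i => Num.min (b i) (d i)).
  - by rewrite setIT; exact: box0.
  - by move=> _ [[a b] _ <-]; rewrite oboxI; exact: box0.
  - move=> S mS S0.
    have mk : measurable (@cube R n k%:R) by exact: measurable_cube.
    have : (\int[mu]_(x in (cube k%:R `&` S) `|` (cube k%:R `&` ~` S)) (r x)%:E
      = 0)%E.
      by rewrite -setIUr setUv setIT; exact: box0.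
    rewrite integral_setU ?S0 ?add0e//.
    + exact: measurableI.
    + by apply: measurableI => //; exact: measurableC.
    + by apply/measurable_EFinP; exact: measurable_funS mr.
    + by apply/disj_setPS => x [[_ ?] [_ ?]].
  - move=> F mF tF F0; rewrite setI_bigcupr integral_bigcup//.
    + by apply: eseries0 => m _ _; exact: F0.
    + by move=> i j _ _ [x [[_ Fi] [_ Fj]]]; apply: tF => //; exists x.
    + by move=> m; apply: measurableI => //; exact: measurable_cube.
    + rewrite -setI_bigcupr; apply: ir; exact: bigcupT_measurable.
have ae_cube k : ae_eq mu (cube k%:R) (EFin \o r) (cst 0%E).
  apply: integral_ae_eq => //.
  - exact: measurable_cube.
  - have := @Lfun2_integrable (cube k%:R) r; apply => //.
      exact: measurable_cube.
    exact: lebesgue_rV_cube_lty.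
  - move=> E Ek mE; rewrite integral0.
    by rewrite -(cubeE k E mE) setIidr.
(* Integer cubes exhaust the space, and a countable union of null sets is null. *)
have : {ae mu, forall x k, cube k%:R x -> (EFin \o r) x = 0%E}.
  by apply/ae_foralln => k; exact: ae_cube.
apply: filterS => x xk;
  have [M xM] := obox_sub_cube (fun i => x ord0 i - 1) (fun i => x ord0 i + 1).
have := xk (Num.truncn M).+1; rewrite /= => h; apply: EFin_inj; apply: h.
apply: (@cube_le _ n M); first by rewrite ltW// Num.Theory.truncnS_gt.
by apply: xM => i; rewrite in_itv/= ltrBlDr ltrDl ltr01.
Qed.

End bumps.

(** * Weak gradients of test functions *)

Section sobolev_test.
Context {R : realType} {n : nat}.
Notation RN := 'rV[R]_n.
Notation mu := (lebesgue_rV R n).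
Implicit Types (u v phi psi : RN -> R) (i : 'I_n).

Lemma ae_eq_Rintegral d (T : measurableType d) (nu : {measure set T -> \bar R})
    (f g : T -> R) : measurable_fun setT f -> measurable_fun setT g ->
  {ae nu, forall x, f x = g x} -> \int[nu]_x f x = \int[nu]_x g x.
Proof.
move=> mf mg fg; congr fine; apply: ae_eq_integral => //.
- exact/measurable_EFinP.
- exact/measurable_EFinP.
- by apply: filterS fg => x /= -> .
Qed.

Lemma Rintegral_sum d (T : measurableType d) (nu : {measure set T -> \bar R})
    (I : Type) (s : seq I) (f : I -> T -> R) :
  (forall k, nu.-integrable setT (EFin \o f k)) ->
  nu.-integrable setT (EFin \o (fun x => \sum_(k <- s) f k x)) /\
  \int[nu]_x (\sum_(k <- s) f k x) = \sum_(k <- s) \int[nu]_x f k x.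
Proof.
move=> fi; elim: s => [|k s [isum Es]].
  rewrite (_ : (fun _ => _) = cst 0); last by apply/funext => x;
    rewrite big_nil.
  by rewrite big_nil Rintegral_cst// mul0r; split=> //; exact: integrable0.
rewrite (_ : (fun _ => _) = (fun x => f k x + \sum_(l <- s) f l x)); last first.
  by apply/funext => x; rewrite big_cons.
rewrite big_cons RintegralD// Es; split=> //.
by apply: (integrableD _ (fi k) isum).
Qed.

Lemma weak_partialP u i : H1 u ->
  weak_partial i u \in Lfun mu 2%:E /\ is_weak_partial i u (weak_partial i u).
Proof.
move=> [_ /(_ i)[g g2 gw]].
by have := @xgetPex _ (cst 0) [set g | g \in Lfun mu 2%:E /\
  is_weak_partial i u g]
  (ex_intro _ g (conj g2 gw)).
Qed.

(** [weak_partial] is an arbitrary choice among the weak derivatives. Its difference with the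
    classical derivative is orthogonal to all test functions, so the two agree almost everywhere. *)
Lemma weak_partial_test phi i : test_function phi ->
  {ae mu, forall x, weak_partial i phi x = partial i phi x}.
Proof.
move=> tphi; have [w2 wphi] := weak_partialP i (test_H1 tphi).
have tdphi := test_partial i tphi; have d2 := test_Lfun2 tdphi.
have r2 : weak_partial i phi \- partial i phi \in Lfun mu 2%:E.
  have p1 : (1 <= 2%:E :> \bar R)%E by rewrite lee_fin ler1n.
  have [_ cl] := Lfun_addr_closed mu p1.
  by apply: (cl (weak_partial i phi) (- partial i phi)) => //;
    exact: Lfun_oppr_closed.
have : {ae mu, forall x, (weak_partial i phi \- partial i phi) x = 0}.
  apply: fundamental_lemma => // psi tpsi; have p2 := test_Lfun2 tpsi.
  transitivity (\int[mu]_x (weak_partial i phi x * psi x - partial i phi x *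
    psi x)).
    by apply: eq_Rintegral => x _; rewrite mulrBl.
  rewrite RintegralB//; [|exact: Lfun2_mul_integrable..].
  have := wphi psi tpsi;
    rewrite (test_weak_partial i tphi tpsi) => /oppr_inj ->.
  by rewrite subrr.
by apply: filterS => x /eqP; rewrite subr_eq0 => /eqP.
Qed.

Definition laplacian phi : RN -> R := fun x =>
  \sum_i partial i (partial i phi) x.

(** The chosen weak derivatives of [phi] are replaced by the classical ones, which are themselves
    test functions; the definition of the weak derivatives of [u] then moves the second derivative
    onto [phi]. *)
Lemma integral_grad_test u phi : H1 u -> test_function phi ->
  mu.-integrable setT (EFin \o (fun x => u x * laplacian phi x)) /\
  \int[mu]_x (\sum_i weak_partial i u x * weak_partial i phi x) =
  - \int[mu]_x (u x * laplacian phi x).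
Proof.
move=> Hu tphi; have u2 := Hu.1.
have iul i : mu.-integrable setT (EFin \o (fun x =>
  u x * partial i (partial i phi) x)).
  by apply: Lfun2_mul_integrable => //;
    exact/test_Lfun2/test_partial/test_partial.
have [i1 E1] := Rintegral_sum (index_enum 'I_n) iul.
rewrite (_ : (fun x => u x * laplacian phi x) =
  (fun x => \sum_i (u x * partial i (partial i phi) x))); last first.
  by apply/funext => x; rewrite mulr_sumr.
split=> //; rewrite E1 -sumrN.
have [|_ ->] := @Rintegral_sum _ _ mu _ (index_enum 'I_n)
    (fun i x => weak_partial i u x * weak_partial i phi x).
  move=> i; apply: Lfun2_mul_integrable; first exact: (weak_partialP i Hu).1.
  exact: (weak_partialP i (test_H1 tphi)).1.
apply: eq_bigr => i _; have [wu2 wu] := weak_partialP i Hu.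
have [wp2 _] := weak_partialP i (test_H1 tphi).
have tdphi := test_partial i tphi.
rewrite (wu _ tdphi) opprK; apply: ae_eq_Rintegral.
- by apply: measurable_funM; exact: Lfun2_measurable.
- by apply: measurable_funM;
    [exact: Lfun2_measurable|exact: (Lfun2_measurable (test_Lfun2 tdphi))].
- by apply: filterS (weak_partial_test i tphi) => x ->.
Qed.

End sobolev_test.

(** * The Laplacian of the product bumps *)

Section cube_bump.
Context {R : realType}.

Definition dbump1 (k a b t : R) : R :=
  k * (flat 2 (k * t - k * a) * flat 0 (- k * t + k * b) -
       flat 0 (k * t - k * a) * flat 2 (- k * t + k * b)).

Definition ddbump1 (k a b t : R) : R :=
  k ^+ 2 * ((flat 4 (k * t - k * a) - 2 * flat 3 (k * t - k * a)) *
              flat 0 (- k * t + k * b) -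
            2 * flat 2 (k * t - k * a) * flat 2 (- k * t + k * b) +
            flat 0 (k * t - k * a) *
              (flat 4 (- k * t + k * b) - 2 * flat 3 (- k * t + k * b))).

Lemma is_derive_flat_affine m (c d t : R) :
  is_derive t 1 (fun s : R => flat m (c * s + d)) (c * dflat m (c * t + d)).
Proof. by apply: is_derive_affine; exact: is_derive_flat. Qed.

Lemma is_derive_bump1 (k a b t : R) :
  is_derive t 1 (bump1 k a b) (dbump1 k a b t).
Proof.
have d1 := is_derive_flat_affine 0 k (- (k * a)) t.
have d2 := is_derive_flat_affine 0 (- k) (k * b) t.
apply: is_derive_eq (is_deriveM d1 d2) _.
by rewrite /dbump1 /dflat /GRing.scale/= !mul0r !subr0; ring.
Qed.

Lemma is_derive_dbump1 (k a b t : R) :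
  is_derive t 1 (dbump1 k a b) (ddbump1 k a b t).
Proof.
have d1 := is_derive_flat_affine 0 k (- (k * a)) t.
have d2 := is_derive_flat_affine 0 (- k) (k * b) t.
have d3 := is_derive_flat_affine 2 k (- (k * a)) t.
have d4 := is_derive_flat_affine 2 (- k) (k * b) t.
have d : is_derive t 1 (dbump1 k a b) _ :=
  is_deriveZ k (is_deriveB (is_deriveM d3 d2) (is_deriveM d1 d4)).
apply: is_derive_eq d _.
by rewrite /ddbump1 /dflat /GRing.scale/= !mul0r !subr0; ring.
Qed.

(* With [p = 1/(1+t/r)], [q = 1/(1-t/r)] and [s = p + q = 2pq], the quotient
   [r^2 w''/w] is [(p^2-q^2)^2 - 2p^3 - 2q^3 = s^4 - 4s^3 + 3s^2]. *)
Lemma ddbump1_ge (r t : R) : 0 < r ->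
  - (9 * r^-1 ^+ 2) * bump1 r^-1 (- r) r t <= ddbump1 r^-1 (- r) r t.
Proof.
move=> r0; rewrite /bump1 /ddbump1 mulrN opprK mulVf ?gt_eqF//.
have -> : - r^-1 * t = - (r^-1 * t) by rewrite mulNr.
have [A0|A0] := leP (r^-1 * t + 1) 0.
  by rewrite !(flat_le0 _ A0); lra.
have [B0|B0] := leP (- (r^-1 * t) + 1) 0.
  by rewrite !(flat_le0 _ B0); lra.
move: (r^-1 * t) A0 B0 => s A0 B0; rewrite /flat A0 B0.
have pq : (s + 1)^-1 + (- s + 1)^-1 = 2 * ((s + 1)^-1 * (- s + 1)^-1).
  by field; rewrite gt_eqF//= gt_eqF.
move: pq; set p := (s + 1)^-1; set q := (- s + 1)^-1 => pq.
rewrite !expr0 !mul1r.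
set E := expR (- p); set F := expR (- q).
have EF : 0 <= r^-1 ^+ 2 * (E * F) by rewrite mulr_ge0 ?sqr_ge0 ?mulr_ge0
  ?expR_ge0.
rewrite -subr_ge0.
suff : 0 <= r^-1 ^+ 2 * (E * F) * (p ^+ 4 - 2 * p ^+ 3 - 2 * p ^+ 2 * q ^+ 2 +
  q ^+ 4 - 2 * q ^+ 3 + 9).
  by congr (0 <= _); ring.
apply: mulr_ge0 => //.
(* With s = p + q the polynomial is s^4 - 4s^3 + 3s^2 + 9, and the constant 9 lets it be written as
   two squares plus 4. *)
suff -> : p ^+ 4 - 2 * p ^+ 3 - 2 * p ^+ 2 * q ^+ 2 + q ^+ 4 - 2 * q ^+ 3 + 9 =
    ((p + q) ^+ 2 - 2 * (p + q) - 1) ^+ 2 + ((p + q) - 2) ^+ 2 + 4.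
  by rewrite addr_ge0// addr_ge0// sqr_ge0.
transitivity ((p + q) ^+ 4 - 4 * (p * q) * (p + q) ^+ 2
  - 2 * ((p + q) ^+ 3 - 3 * (p * q) * (p + q)) + 9); first by ring.
have -> : p * q = (p + q) / 2 by rewrite pq; field.
by field.
Qed.

(** With s = t/r and |s| < 1/2 the exponent is -2/(1 - s^2) >= -8/3 >= -3. *)
Lemma bump1_ge (r t : R) : 0 < r -> t \in `](- (r / 2)), (r / 2)[ ->
  expR (- 3) <= bump1 r^-1 (- r) r t.
Proof.
move=> r0; rewrite in_itv/= => /andP[rt tr].
rewrite /bump1 mulrN opprK mulVf ?gt_eqF//.
have -> : - r^-1 * t = - (r^-1 * t) by rewrite mulNr.
have : - (1 / 2) < r^-1 * t by rewrite [r^-1 * t]mulrC ltr_pdivlMr//; lra.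
have : r^-1 * t < 1 / 2 by rewrite [r^-1 * t]mulrC ltr_pdivrMr//; lra.
move: (r^-1 * t) => s s1 s2.
have A0 : 0 < s + 1 by lra.
have B0 : 0 < - s + 1 by lra.
rewrite /flat A0 B0 !expr0 !mul1r -expRD ler_expR -opprD lerN2.
have -> : (s + 1)^-1 + (- s + 1)^-1 = 2 / ((s + 1) * (- s + 1)).
  by field; rewrite gt_eqF//= gt_eqF.
rewrite ler_pdivrMr ?mulr_gt0//; nra.
Qed.

Context {n : nat}.
Notation RN := 'rV[R]_n.
Notation mu := (lebesgue_rV R n).

Definition bumpr (r : R) : RN -> R := bump r^-1 (fun=> - r) (fun=> r).

Lemma laplacian_bumpr (r : R) (x : RN) : 0 < r ->
  - (9 * n%:R / r ^+ 2) * bumpr r x <= laplacian (bumpr r) x.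
Proof.
move=> r0.
have p1 i : partial i (bumpr r) = fun x : RN => dbump1 r^-1 (- r) r (x ord0 i) *
    \prod_(j | j != i) bump1 r^-1 (- r) r (x ord0 j).
  apply/funext => y.
  have [_] := @is_derive_tensor _ _ (fun=> bump1 r^-1 (- r) r) _ i y
    (is_derive_bump1 r^-1 (- r) r (y ord0 i)).
  by apply.
have p2 i : partial i (partial i (bumpr r)) = fun x : RN =>
  ddbump1 r^-1 (- r) r (x ord0 i) *
    \prod_(j | j != i) bump1 r^-1 (- r) r (x ord0 j).
  rewrite p1; apply/funext => y.
  (* The first derivative is again a tensor product, with a different i-th factor, so
     [is_derive_tensor] applies a second time. *)
  pose w j := if j == i then dbump1 r^-1 (- r) r else bump1 r^-1 (- r) r.
  have -> : (fun x : RN => dbump1 r^-1 (- r) r (x ord0 i) *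
    \prod_(j | j != i) bump1 r^-1 (- r) r (x ord0 j)) =
    fun x => \prod_j w j (x ord0 j).
    apply/funext => z; rewrite [RHS](bigD1 i)//= /w eqxx; congr (_ * _).
    by apply: eq_bigr => j /negbTE ->.
  rewrite /partial;
    have [|_ ->] := @is_derive_tensor _ _ w (ddbump1 r^-1 (- r) r (y ord0 i)) i
      y.
    by rewrite /w eqxx; exact: is_derive_dbump1.
  by congr (_ * _); apply: eq_bigr => j /negbTE ji; rewrite /w ji.
rewrite /laplacian.
have -> : - (9 * n%:R / r ^+ 2) * bumpr r x =
    \sum_(i < n) - (9 * r^-1 ^+ 2) * bumpr r x.
  by rewrite sumr_const card_ord -mulrnAl -mulr_natl exprVn; congr (_ * _);
    ring.
apply: ler_sum => i _; rewrite p2 /bumpr /bump (bigD1 i)//= mulrA ler_wpM2r//.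
  by apply: prodr_ge0 => j _; exact: bump1_ge0.
exact: ddbump1_ge.
Qed.

Lemma bumpr_ge (r : R) (x : RN) : 0 < r -> cube (r / 2) x ->
  expR (- 3) ^+ n <= bumpr r x.
Proof.
move=> r0 xr; have -> : expR (- 3) ^+ n = \prod_(i < n) expR (- 3) :> R.
  by rewrite prodr_const card_ord.
by apply: ler_prod => i _; rewrite expR_ge0 bump1_ge.
Qed.

End cube_bump.

(** * Almost everywhere estimates *)

Section ae_integral.
Context d (T : measurableType d) (R : realType) (mu : {measure set T ->
  \bar R}).
Implicit Types (f g : T -> R) (A : set T).

Lemma integrable_EFin_measurable f :
  mu.-integrable setT (EFin \o f) -> measurable_fun setT f.
Proof. by move=> /measurable_int/measurable_EFinP. Qed.

Lemma integrableZ (k : R) f : mu.-integrable setT (EFin \o f) ->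
  mu.-integrable setT (EFin \o (fun x => k * f x)).
Proof. by move=> fi; exact: (integrableZl measurableT k fi). Qed.

Lemma ae_le_integrable f g : measurable_fun setT f ->
  mu.-integrable setT (EFin \o g) -> {ae mu, forall x, `|f x| <= g x} ->
  mu.-integrable setT (EFin \o f).
Proof.
move=> mf /[dup] ig /integrableP[_ goo] fg;
  have mg := integrable_EFin_measurable ig.
apply/integrableP; split; first exact/measurable_EFinP.
apply: le_lt_trans goo; apply: ae_ge0_le_integral => //.
- by apply/measurable_EFinP; exact: measurableT_comp.
- by apply/measurable_EFinP; exact: measurableT_comp.
- by apply: filterS fg => x fgx _; rewrite lee_fin (le_trans fgx)// ler_norm.
Qed.

Lemma ae_ge0_Rintegral f : measurable_fun setT f ->
  {ae mu, forall x, 0 <= f x} -> 0 <= \int[mu]_x f x.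
Proof.
move=> mf f0; rewrite (@ae_eq_Rintegral _ _ _ _ _ (fun x =>
  `|f x|)) ?Rintegral_ge0//.
  exact: measurableT_comp.
by apply: filterS f0 => x fx; rewrite ger0_norm.
Qed.

Lemma ae_le_Rintegral f g : mu.-integrable setT (EFin \o f) ->
  mu.-integrable setT (EFin \o g) -> {ae mu, forall x, f x <= g x} ->
  \int[mu]_x f x <= \int[mu]_x g x.
Proof.
move=> fi gi fg; rewrite -subr_ge0 -RintegralB//; apply: ae_ge0_Rintegral.
  by apply: measurable_funB; exact: integrable_EFin_measurable.
by apply: filterS fg => x; rewrite subr_ge0.
Qed.

Lemma Rintegral_eq0_ae f : mu.-integrable setT (EFin \o f) ->
  {ae mu, forall x, 0 <= f x} -> \int[mu]_x f x = 0 ->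
  {ae mu, forall x, f x = 0}.
Proof.
move=> fi f0 If0; have mf := integrable_EFin_measurable fi.
have : (\int[mu]_x `|(f x)%:E| = 0)%E.
  transitivity (\int[mu]_x (f x)%:E)%E.
    apply: ae_eq_integral => //.
    - by apply/measurable_EFinP; exact: measurableT_comp.
    - exact/measurable_EFinP.
    - by apply: filterS f0 => x fx _ /=; rewrite ger0_norm.
  have fin : (\int[mu]_x (f x)%:E)%E \is a fin_num.
    exact: (integrable_fin_num measurableT fi).
  by rewrite -(fineK fin); congr EFin.
move=> fa0; have mfE : measurable_fun setT (EFin \o f) by
  exact/measurable_EFinP.
have : ae_eq mu setT (EFin \o f) (cst 0%E).
  by apply/(ae_eq_integral_abs mu measurableT mfE).
by apply: filterS => x fx; apply: EFin_inj; exact: fx.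
Qed.

Lemma Rintegral_gt0 f A : mu.-integrable setT (EFin \o f) ->
  {ae mu, forall x, 0 <= f x} -> measurable A -> (0 < mu A)%E ->
  {ae mu, forall x, A x -> 0 < f x} -> 0 < \int[mu]_x f x.
Proof.
move=> fi f0 mA A0 fA; rewrite lt_neqAle ae_ge0_Rintegral ?andbT//; last first.
  exact: integrable_EFin_measurable.
apply/eqP => /esym If0; have fx0 := Rintegral_eq0_ae fi f0 If0.
suff : mu A = 0%E by move=> muA; rewrite muA ltxx in A0.
have : {ae mu, forall x, ~ A x}.
  by apply: filterS2 fx0 fA => x -> /[swap] Ax /(_ Ax); rewrite ltxx.
move=> [N [mN N0 AN]]; apply: (subset_measure0 mA mN _ N0).
by move=> x Ax; apply: AN => /=; exact.
Qed.

(** The extended integral is [+oo], which [fine] sends to 0. This default value has to be excluded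
    before any equation tested with [u] can be exploited. *)
Lemma Rintegral_not_integrable f : measurable_fun setT f ->
  {ae mu, forall x, 0 <= f x} -> ~ mu.-integrable setT (EFin \o f) ->
  \int[mu]_x f x = 0.
Proof.
move=> mf f0 fi; rewrite (@ae_eq_Rintegral _ _ _ _ _ (fun x => `|f x|))//;
  last 2 first.
- exact: measurableT_comp.
- by apply: filterS f0 => x fx; rewrite ger0_norm.
rewrite /Rintegral; suff -> : (\int[mu]_x (`|f x|)%:E = +oo)%E by [].
apply/eqP; rewrite -leye_eq leNgt; apply/negP => foo; apply: fi.
by apply/integrableP; split; first exact/measurable_EFinP.
Qed.

End ae_integral.

(** * A scaled Young inequality *)

Section young.
Context {R : realType}.

(* With [x] the value of [u] and [r] the radius of the test function, the
   condition on [t] says that [r^(-2t/(t-1)) <= r^(-n)]. *)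
Lemma young_scaled (n : nat) (t K x r : R) : 1 < t -> n%:R * (t - 1) <= 2 * t ->
  0 < K -> 0 <= x -> 1 <= r ->
  x / r ^+ 2 <= K * x `^ t + K `^ (- (t - 1)^-1) / r ^+ n.
Proof.
move=> t1 nt K0 x0 r1; have r0 : 0 < r by rewrite (lt_le_trans _ r1).
have t10 : 0 < t - 1 by rewrite subr_gt0.
have [->|xn0] := eqVneq x 0.
  rewrite mul0r powR0 ?gt_eqF ?(lt_trans _ t1)// mulr0 add0r.
  by rewrite mulr_ge0 ?powR_ge0// invr_ge0 exprn_ge0 ?ltW.
have {x0}xgt0 : 0 < x by rewrite lt_neqAle eq_sym xn0.
have xt : x `^ t = x * x `^ (t - 1).
  rewrite -{2}(powRr1 (ltW xgt0)) -powRD ?xn0 ?implybT//.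
  by congr (_ `^ _); ring.
(* If x^(t-1) is at least 1/(K r^2), the first term on the right dominates. Otherwise [x] is less
   than (r^-2 / K)^(1/(t-1)), and the second term dominates. *)
have [le1|gt1] := leP (r ^- 2) (K * x `^ (t - 1)).
  apply: (@le_trans _ _ (K * x `^ t)).
    by rewrite xt mulrCA ler_wpM2l// ltW.
  by rewrite lerDl mulr_ge0 ?powR_ge0// invr_ge0 exprn_ge0 ?ltW.
apply: (@le_trans _ _ (K `^ (- (t - 1)^-1) / r ^+ n)); last first.
  by rewrite lerDr mulr_ge0 ?powR_ge0// ltW.
set e := (t - 1)^-1; have e0 : 0 < e by rewrite invr_gt0.
have xle : x <= (r ^- 2) `^ e * K `^ (- e).
  have xE : x = (x `^ (t - 1)) `^ e.
    by rewrite -powRrM mulfV ?gt_eqF// powRr1// ltW.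
  have -> : (r ^- 2) `^ e * K `^ (- e) = (r ^- 2 / K) `^ e.
    by rewrite powRM ?invr_ge0 ?exprn_ge0 ?ltW// -(powR_inv1 (ltW K0)) -powRrM
      mulN1r.
  rewrite [leLHS]xE; apply: ge0_ler_powR.
  - exact: ltW.
  - by rewrite nnegrE powR_ge0.
  - by rewrite nnegrE mulr_ge0 ?invr_ge0 ?exprn_ge0 ?ltW.
  - by rewrite ler_pdivlMr// mulrC ltW.
have r2 : 0 <= r ^- 2 by rewrite invr_ge0 exprn_ge0 ?ltW.
apply: le_trans (ler_wpM2r r2 xle) _.
rewrite mulrAC mulrC ler_wpM2l ?powR_ge0// -{2}(powRr1 r2) -powRD; last first.
  by rewrite invr_eq0 expf_eq0/= (gt_eqF r0) implybT.
(* Both sides are now powers of [r], and r >= 1, so it suffices to compare the exponents 2t/(t-1)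
   and n. *)
rewrite -(powR_invn 2 (ltW r0)) -powRrM -(powR_invn n (ltW r0)) ler_powR//.
rewrite mulNr lerN2.
suff -> : 2 * (e + 1) = 2 * t / (t - 1) by rewrite ler_pdivlMr.
by rewrite /e; field; rewrite gt_eqF.
Qed.

End young.

(** * Positive supersolutions *)

Section supersolutions.
Context {R : realType} {n : nat}.
Notation RN := 'rV[R]_n.
Notation mu := (lebesgue_rV R n).
Implicit Types (u h : RN -> R) (lambda : R).

Lemma bumpr_test (r : R) : 0 < r -> test_function (@bumpr R n r).
Proof. by move=> r0; apply: bump_test; rewrite invr_gt0. Qed.

Lemma mul_test_integrable u phi : u \in Lfun mu 2%:E -> test_function phi ->
  mu.-integrable setT (EFin \o (fun x => u x * phi x)).
Proof. by move=> u2 /test_Lfun2; exact: Lfun2_mul_integrable. Qed.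

(** Moving the derivatives onto the bump leaves the integral of u times -Delta phi_r, and
    [laplacian_bumpr] bounds the latter factor pointwise; positivity of [u] preserves the
    inequality. *)
Lemma grad_bumpr_le u (r : R) : H1 u -> {ae mu, forall x, 0 < u x} -> 0 < r ->
  \int[mu]_x (\sum_i weak_partial i u x * weak_partial i (bumpr r) x) <=
  9 * n%:R / r ^+ 2 * \int[mu]_x (u x * bumpr r x).
Proof.
move=> Hu u0 r0; have tb := bumpr_test r0.
have [il ->] := integral_grad_test Hu tb.
have ib := mul_test_integrable Hu.1 tb.
rewrite -RintegralZl// -[leLHS]mulN1r -RintegralZl//.
apply: ae_le_Rintegral; [exact: integrableZ|exact: integrableZ|].
apply: filterS u0 => x ux;
  rewrite mulN1r -mulrN [leRHS]mulrCA ler_wpM2l ?(ltW ux)//.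
by have := laplacian_bumpr x r0; rewrite mulNr lerNl.
Qed.

Lemma obox_gt0 (a b : 'I_n -> R) : (forall i, a i < b i) ->
  (0 < mu (obox a b))%E.
Proof.
move=> ab; rewrite lebesgue_rV_obox// lte_fin prodr_gt0// => i _.
by rewrite subr_gt0.
Qed.

Lemma integral_mul_bump_gt0 u (k : R) (a b : 'I_n -> R) :
  0 < k -> (forall i, a i < b i) -> {ae mu, forall x, 0 < u x} ->
  mu.-integrable setT (EFin \o (fun x => u x * bump k a b x)) ->
  0 < \int[mu]_x (u x * bump k a b x).
Proof.
move=> k0 ab u0 iub.
apply: (Rintegral_gt0 iub _ (measurable_obox a b) (obox_gt0 ab)).
  by apply: filterS u0 => x ux; rewrite mulr_ge0 ?bump_ge0 ?ltW.
by apply: filterS u0 => x ux abx; rewrite mulr_gt0// bump_gt0.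
Qed.

(** For negative [lambda] and large [r], the bound 9n/r^2 + lambda is negative. The equation tested
    with the bump would then equate a negative number with the integral of a nonnegative
    function. *)
Lemma multiplier_ge0 u h lambda : H1 u -> {ae mu, forall x, 0 < u x} ->
  (forall x, 0 <= h x) -> weak_solution lambda u h -> 0 <= lambda.
Proof.
move=> Hu u0 h0 uh; rewrite leNgt; apply/negP => l0.
(* Since r >= 1, r^2 >= r > 9n/(-lambda), that is 9n/r^2 < -lambda. *)
pose r := 1 + 9 * n%:R / (- lambda).
have nl : 0 <= 9 * n%:R / (- lambda) by rewrite divr_ge0 ?mulr_ge0// oppr_ge0
  ltW.
have r0 : 0 < r by rewrite ltr_wpDr.
have tb := bumpr_test r0.
have up : 0 < \int[mu]_x (u x * bumpr r x).
  apply: integral_mul_bump_gt0 => //; first by rewrite invr_gt0.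
    by move=> i; rewrite gtrN.
  exact: mul_test_integrable Hu.1 tb.
have : 0 <= \int[mu]_x (h x * bumpr r x).
  by apply: Rintegral_ge0 => x _; rewrite mulr_ge0// bump_ge0.
rewrite -(uh _ (test_H1 tb)); apply/negP; rewrite -ltNge.
apply: le_lt_trans (lerD (grad_bumpr_le Hu u0 r0) (lexx _)) _.
rewrite -mulrDl pmulr_llt0// -ltrBrDr sub0r.
rewrite ltr_pdivrMr ?exprn_gt0// [ltRHS]mulrC -ltr_pdivrMr ?oppr_gt0//.
apply: (@lt_le_trans _ _ r); first by rewrite /r ltrDr.
by rewrite -{1}(mulr1 r) expr2 ler_wpM2l ?(ltW r0)// /r lerDl.
Qed.

Lemma dirichlet_ge0 u : 0 <= dirichlet u.
Proof. by apply: Rintegral_ge0 => x _; apply: sumr_ge0 => i _;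
  rewrite sqr_ge0. Qed.

Lemma dirichlet_integrable u : H1 u ->
  mu.-integrable setT (EFin \o (fun x => \sum_i weak_partial i u x ^+ 2)).
Proof.
move=> Hu; apply: (Rintegral_sum (index_enum 'I_n)
  (f := fun i x => weak_partial i u x ^+ 2) _).1 => i.
exact/Lfun2_integrable_sqr/(weak_partialP i Hu).1.
Qed.

Lemma dirichlet_eq0 u : H1 u -> dirichlet u = 0 ->
  {ae mu, forall x i, weak_partial i u x = 0}.
Proof.
move=> Hu du0.
have := Rintegral_eq0_ae (dirichlet_integrable Hu) _ du0.
have s0 : {ae mu, forall x, 0 <= \sum_i weak_partial i u x ^+ 2}.
  by apply: aeW => x; apply: sumr_ge0 => i _; rewrite sqr_ge0.
move=> /(_ s0); apply: filterS => x /eqP; rewrite psumr_eq0 => [|i _];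
  last exact: sqr_ge0.
move=> /allP wx i; have := wx i (mem_index_enum _).
by rewrite sqrf_eq0 => /eqP.
Qed.

(* A divergent [\int h u] would be read as [0], so that [u] would have zero
   gradient; testing with a bump where [h] is bounded excludes this. *)
Lemma rhs_mul_integrable u h lambda (C : R) (a b : 'I_n -> R) :
  H1 u -> {ae mu, forall x, 0 < u x} -> 0 < \int[mu]_x (u x * u x) ->
  (forall x, 0 <= h x) -> measurable_fun setT h -> {ae mu, forall x, 0 < h x} ->
  weak_solution lambda u h -> (forall i, a i < b i) ->
  {ae mu, forall x, obox a b x -> h x <= C} ->
  mu.-integrable setT (EFin \o (fun x => h x * u x)).
Proof.
move=> Hu u0 uu0 h0 mh hp uh ab hC; apply: contrapT => nhu.
have mu_ := Lfun2_measurable Hu.1.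
have huI : \int[mu]_x (h x * u x) = 0.
  apply: Rintegral_not_integrable => //; first exact: measurable_funM.
  by apply: filterS u0 => x ux; rewrite mulr_ge0// ltW.
have l0 := multiplier_ge0 Hu u0 h0 uh.
have := uh u Hu; rewrite huI.
have -> : \int[mu]_x (\sum_i weak_partial i u x * weak_partial i u x) =
  dirichlet u.
  by apply: eq_Rintegral => x _; apply: eq_bigr => i _; rewrite expr2.
have d0 := dirichlet_ge0 u => E.
(* The equation tested with [u] now reads: Dirichlet energy plus lambda times the squared L^2 norm
   is 0. Both terms are nonnegative and the norm is positive, so the energy and [lambda] vanish. *)
have lu0 : 0 <= lambda * \int[mu]_x (u x * u x) by rewrite mulr_ge0// ltW.
have du : dirichlet u = 0 by apply/eqP; rewrite eq_le d0 andbT; lra.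
have lambda0 : lambda = 0.
  by apply/eqP; rewrite -(mulIr_eq0 lambda (mulIf (lt0r_neq0 uu0))); apply/eqP;
    lra.
have tb : test_function (bump 1 a b) by apply: bump_test.
have := uh _ (test_H1 tb); rewrite lambda0 mul0r addr0.
rewrite (@ae_eq_Rintegral _ _ _ _ _ (cst 0)); last first.
- apply: filterS (dirichlet_eq0 Hu du) => x wx.
  by rewrite big1// => i _; rewrite wx mul0r.
- exact: measurable_cst.
- apply: measurable_sum => i; apply: measurable_funM.
    exact: (Lfun2_measurable (weak_partialP i Hu).1).
  exact: (Lfun2_measurable (weak_partialP i (test_H1 tb)).1).
rewrite Rintegral_cst// mul0r => /esym hb0.
suff : 0 < \int[mu]_x (h x * bump 1 a b x) by rewrite hb0 ltxx.
apply: integral_mul_bump_gt0 => //.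
have mb := Lfun2_measurable (test_Lfun2 tb).
apply: (@ae_le_integrable _ _ _ _ _ (fun x => C * \1_(obox a b) x)).
- exact: measurable_funM.
- apply: integrableZ;
    apply: (integrable_bounded_support (A := obox a b) (C := 1)) => //.
  + exact: measurable_obox.
  + exact: obox_lty.
  + by apply: measurable_indic; exact: measurable_obox.
  + by move=> x abx; rewrite indicE mem_set// normr1.
  + by move=> x abx; rewrite indicE memNset.
- apply: filterS hC => x hxC; rewrite ger0_norm ?mulr_ge0 ?bump_ge0//.
  have [abx|abx] := pselect (obox a b x);
    last by rewrite bump_eq0// indicE memNset// !mulr0.
  by rewrite indicE mem_set// mulr1 (le_trans _ (hxC abx))// ler_piMr//
    bump_le1.
Qed.

(** On the cube that carries the bump, phi_r <= 1 <= u/c, so h phi_r is dominated by h u / c. *)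
Lemma rhs_bumpr_integrable u h (r c : R) : 0 < r -> 0 < c ->
  (forall x, 0 <= h x) -> measurable_fun setT h ->
  {ae mu, forall x, cube r x -> c <= u x} ->
  mu.-integrable setT (EFin \o (fun x => h x * u x)) ->
  mu.-integrable setT (EFin \o (fun x => h x * bumpr r x)).
Proof.
move=> r0 c0 h0 mh uc ihu;
  have mb := Lfun2_measurable (test_Lfun2 (bumpr_test r0)).
have ihu' := integrable_norm ihu.
apply: (@ae_le_integrable _ _ _ _ _ (fun x => c^-1 * `|h x * u x|)).
- exact: measurable_funM.
- exact: integrableZ.
apply: filterS uc => x ucx; rewrite ger0_norm ?mulr_ge0 ?bump_ge0//.
have [rx|rx] := pselect (cube r x); last first.
  by rewrite /bumpr bump_eq0 ?invr_gt0// mulr0 mulr_ge0// invr_ge0 ltW.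
have {}ucx := ucx rx; have ux : 0 < u x by rewrite (lt_le_trans c0).
rewrite (ger0_norm (mulr_ge0 (h0 x) (ltW ux))) mulrCA ler_wpM2l//.
rewrite [leRHS]mulrC ler_pdivlMr// (le_trans _ ucx)//.
by rewrite ler_piMl ?(ltW c0)// bump_le1.
Qed.

End supersolutions.

(** * Liouville theorems *)

Section liouville.
Context {R : realType} {n : nat}.
Notation RN := 'rV[R]_n.
Notation mu := (lebesgue_rV R n).
Implicit Types (u h : RN -> R).

Lemma bumpr_integrable (r : R) : 0 < r ->
  mu.-integrable setT (EFin \o @bumpr R n r).
Proof.
move=> r0; have tb := @bumpr_test R n r r0; have [M _ b0] := test_support tb.
by apply: (integrable_cube (test_continuous tb)) => x /b0[].
Qed.

Lemma integral_bumpr_le (r : R) : 0 < r -> \int[mu]_x bumpr r x <= (2 * r) ^+ n.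
Proof.
move=> r0; have mc : measurable (@cube R n r) by exact: measurable_cube.
have E : (\int[mu]_x (\1_(cube r) x)%:E = ((2 * r) ^+ n)%:E)%E.
  by rewrite integral_indic// setIT; exact: lebesgue_rV_cube.
have -> : (2 * r) ^+ n = \int[mu]_x \1_(cube r) x by rewrite /Rintegral E.
apply: ae_le_Rintegral; first exact: bumpr_integrable.
  apply: (integrable_bounded_support (A := cube r) (C := 1)) => //.
  + exact: lebesgue_rV_cube_lty.
  + by move=> x abx; rewrite indicE mem_set// normr1.
  + by move=> x abx; rewrite indicE memNset.
apply: aeW => x; have [rx|rx] := pselect (cube r x).
  by rewrite indicE mem_set// bump_le1.
by rewrite /bumpr bump_eq0 ?invr_gt0.
Qed.

(** Without the subtraction no single integrable function need dominate u/r^2 for all r. Once the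
    term e/r^n is removed, Young's inequality leaves the fixed bound K |u|^t and dominated
    convergence applies. *)
Lemma truncated_integral_cvg0 u (t e : R) : 1 < t -> n%:R * (t - 1) <= 2 * t ->
  0 < e -> measurable_fun setT u ->
  mu.-integrable setT (EFin \o (fun x => `|u x| `^ t)) ->
  (fun m => \int[mu]_x Num.max 0 (`|u x| / m.+1%:R ^+ 2 - e / m.+1%:R ^+ n)%R)
    @ \oo --> (0 : R).
Proof.
move=> t1 nt e0 mu_ iut.
(* The value for which the coefficient K^(-1/(t-1)) of r^-n in Young's inequality is [e]. *)
pose K := e `^ (- (t - 1)).
have K0 : 0 < K by rewrite powR_gt0.
have Ke : K `^ (- (t - 1)^-1) = e.
  by rewrite -powRrM mulrNN mulfV ?powRr1 ?ltW// gt_eqF// subr_gt0.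
pose g m x : R := Num.max 0 (`|u x| / m.+1%:R ^+ 2 - e / m.+1%:R ^+ n).
have mg m : measurable_fun setT (g m).
  apply: measurable_maxr => //; apply: measurable_funB => //.
  by apply: measurable_funM => //; exact: measurableT_comp.
have g0 m x : 0 <= g m x by rewrite /g le_max lexx.
have gK m x : g m x <= K * `|u x| `^ t.
  rewrite /g ge_max mulr_ge0 ?powR_ge0 ?(ltW K0)//= lerBlDr.
  have := @young_scaled _ n t K `|u x| m.+1%:R t1 nt K0.
  by rewrite Ke; apply => //; rewrite ler1n.
have gcvg x : g ^~ x @ \oo --> (0 : R).
  apply: (@squeeze_cvgr _ _ _ _ (fun=> 0) (fun m => `|u x| * harmonic m)).
  - apply: nearW => m; rewrite g0/= /g ge_max mulr_ge0//=.
    apply: (@le_trans _ _ (`|u x| / m.+1%:R ^+ 2)).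
      by rewrite gerBl divr_ge0 ?exprn_ge0// (ltW e0).
    by rewrite ler_wpM2l// lef_pV2 ?posrE ?exprn_gt0// ler_eXnr// ler1n.
  - exact: cvg_cst.
  - by rewrite -(mulr0 `|u x|); apply: cvgM;
      [exact: cvg_cst|exact: cvg_harmonic].
have [||||| _ _] := @dominated_convergence _ _ _ mu setT measurableT
    (fun m x => (g m x)%:E) (cst 0%E) (EFin \o (fun x => K * `|u x| `^ t)).
- by move=> m; apply/measurable_EFinP.
- exact: measurable_cst.
- by apply: aeW => x _; apply: cvg_EFin; [exact: nearW|exact: gcvg].
- exact: integrableZ.
- by apply: aeW => x m _; rewrite /= ger0_norm ?g0// lee_fin gK.
by rewrite integral0 => /fine_cvg.
Qed.

(** u/r^2 is at most its truncated part plus e/r^n. The first tends to 0 in the integral; the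
    second, tested with the bump, contributes at most 2^n e. *)
Lemma rescaled_integral_small u (t d : R) : 1 < t -> n%:R * (t - 1) <= 2 * t ->
  0 < d -> u \in Lfun mu 2%:E ->
  mu.-integrable setT (EFin \o (fun x => `|u x| `^ t)) ->
  exists2 r, 2 <= r & (\int[mu]_x (u x * bumpr r x)) / r ^+ 2 <= d.
Proof.
move=> t1 nt d0 u2 iut; have mu_ := Lfun2_measurable u2.
(* The integral of the bump is at most (2r)^n, so this [e] makes the remainder at most d/2. *)
pose e := d / 2 / 2 ^+ n.
have e0 : 0 < e by rewrite !divr_gt0// exprn_gt0.
have cv0 := truncated_integral_cvg0 t1 nt e0 mu_ iut.
have d20 : 0 < d / 2 by rewrite divr_gt0.
have [m m1 md] : exists2 m, (1 <=
  m)%N & \int[mu]_x Num.max 0 (`|u x| / m.+1%:R ^+ 2 - e / m.+1%:R ^+ n)%R <=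
    d / 2.
  have /cvgr0Pnorm_le/(_ _ d20) := cv0.
  move=> [m0 _ h]; exists (maxn m0 1); first exact: leq_maxr.
  by apply: le_trans (ler_norm _) _; apply: h; rewrite /= leq_maxl.
(* A radius of at least 2 ensures, in [liouville], that the cube of half-side r/2 contains the
   support of the bump of radius 1. *)
exists m.+1%:R; first by rewrite ler_nat.
have r0 : 0 < m.+1%:R :> R by [].
have iub := mul_test_integrable u2 (@bumpr_test R n _ r0).
have ib := bumpr_integrable r0.
set g := fun x => Num.max 0 _ in md.
have ig : mu.-integrable setT (EFin \o g).
  apply: (@ae_le_integrable _ _ _ _ _ (fun x =>
    (e `^ (- (t - 1))) * `|u x| `^ t)).
  - apply: measurable_maxr => //; apply: measurable_funB => //.
    by apply: measurable_funM => //; exact: measurableT_comp.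
  - exact: integrableZ.
  - apply: aeW => x; rewrite ger0_norm ?le_max ?lexx//.
    have K0 : 0 < e `^ (- (t - 1)) by rewrite powR_gt0.
    rewrite /g ge_max mulr_ge0 ?powR_ge0//= lerBlDr.
    have := @young_scaled _ n t _ `|u x| m.+1%:R t1 nt K0.
    rewrite -powRrM mulrNN mulfV ?powRr1 ?(ltW e0)// ?gt_eqF// ?subr_gt0//.
    by apply => //; rewrite ler1n.
rewrite -RintegralZr//.
apply: (@le_trans _ _ (\int[mu]_x (g x + e / m.+1%:R ^+ n * bumpr m.+1%:R x))).
  apply: ae_le_Rintegral.
  - rewrite (_ : EFin \o _ =
      EFin \o (fun x => m.+1%:R ^- 2 * (u x * bumpr m.+1%:R x))).
      exact: integrableZ.
    by apply/funext => x /=; rewrite mulrC.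
  - exact: (integrableD _ ig (integrableZ (e / m.+1%:R ^+ n) ib)).
  apply: aeW => x; have b0 : 0 <= bumpr m.+1%:R x := bump_ge0 _ _ _ _.
  have b1 : bumpr m.+1%:R x <= 1 := bump_le1 _ _ _ _.
  rewrite mulrAC -lerBlDr -mulrBl.
  have gx : u x / m.+1%:R ^+ 2 - e / m.+1%:R ^+ n <= g x.
    rewrite /g le_max; apply/orP; right; rewrite lerD2r.
    by rewrite ler_wpM2r ?ler_norm// invr_ge0 exprn_ge0.
  apply: le_trans (ler_wpM2r b0 gx) _; rewrite ler_piMr//.
  by rewrite /g le_max lexx.
rewrite RintegralD//; last exact: integrableZ.
rewrite RintegralZl//.
rewrite [leRHS]splitr lerD//.
apply: (@le_trans _ _ (e / m.+1%:R ^+ n * (2 * m.+1%:R) ^+ n)).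
  by rewrite ler_wpM2l ?integral_bumpr_le// divr_ge0 ?exprn_ge0 ?(ltW e0).
rewrite /e exprMn le_eqVlt; apply/orP; left; apply/eqP; field.
by rewrite !expf_neq0//=.
Qed.

(** The integral of h phi_r is at most 9n r^-2 times that of u phi_r, which is small for a suitable
    r. It is also at least e^(-3n) times the integral of h phi_1, a positive number independent of
    r. *)
Lemma liouville u h (t : R) : H1 u -> {ae mu, forall x, 0 < u x} ->
  (forall x, 0 <= h x) -> {ae mu, forall x, 0 < h x} ->
  (forall r, 0 < r -> mu.-integrable setT (EFin \o (fun x =>
    h x * bumpr r x))) ->
  1 < t -> n%:R * (t - 1) <= 2 * t ->
  mu.-integrable setT (EFin \o (fun x => `|u x| `^ t)) ->
  ~ weak_solution 0 u h.
Proof.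
move=> Hu u0 h0 hp ih t1 nt iut uh.
have hb : 0 < \int[mu]_x (h x * bumpr 1 x).
  by apply: integral_mul_bump_gt0 (ih 1 ltr01).
pose c : R := expR (- 3) ^+ n; have c0 : 0 < c by rewrite exprn_gt0// expR_gt0.
set I0 := \int[mu]_x _ in hb.
have n0 : 0 <= 9 * n%:R :> R by rewrite mulr_ge0.
(* The denominator 9n + 1 in place of 9n makes the final comparison strict, and is positive in any
   dimension. *)
have d0 : 0 < c * I0 / (9 * n%:R + 1) by rewrite divr_gt0 ?mulr_gt0// ltr_wpDl.
have [r r2] := rescaled_integral_small t1 nt d0 Hu.1 iut.
have r0 : 0 < r by rewrite (lt_le_trans _ r2).
have tb := @bumpr_test R n r r0.
have le1 : c * I0 <= \int[mu]_x (h x * bumpr r x).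
  rewrite /I0 -(RintegralZl c measurableT (ih 1 ltr01)).
  apply: ae_le_Rintegral; [exact/integrableZ/ih|exact: ih|].
  apply: aeW => x; rewrite mulrCA ler_wpM2l//.
  have [x1|x1] := pselect (cube 1 x); last first.
    by rewrite /bumpr bump_eq0 ?invr_gt0// mulr0 bump_ge0.
  apply: (@le_trans _ _ c).
    by rewrite ler_piMr ?(ltW c0)// bump_le1.
  apply: bumpr_ge => //; apply: cube_le x1.
  by rewrite ler_pdivlMr// mul1r.
have := uh _ (test_H1 tb); rewrite mul0r addr0 => E.
move: le1; rewrite -E => /le_trans /(_ (grad_bumpr_le Hu u0 r0)) le2.
rewrite leNgt => /negP; apply.
set X := \int[mu]_x _ in le2 *; rewrite ltr_pdivrMr ?ltr_wpDl//.
have X0 : 0 < X / r ^+ 2.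
  apply: divr_gt0; last exact: exprn_gt0.
  apply: integral_mul_bump_gt0 u0 (mul_test_integrable Hu.1 tb) => [|i].
    by rewrite invr_gt0.
  by rewrite gtrN.
apply: le_lt_trans le2 _; rewrite mulrDr mulr1.
suff -> : 9 * n%:R / r ^+ 2 * X = X / r ^+ 2 * (9 * n%:R) by rewrite ltrDl.
by rewrite mulrAC [RHS]mulrC mulrA.
Qed.

(** Monotone convergence along the integer cubes, which increase to the whole space. *)
Lemma integrable_of_cube_bound (f : RN -> R) (D : R) : measurable_fun setT f ->
  (forall x, 0 <= f x) ->
  (forall m : nat, mu.-integrable setT (EFin \o (fun x =>
    f x * \1_(@cube R n m%:R) x)) /\
    \int[mu]_x (f x * \1_(cube m%:R) x) <= D) ->
  mu.-integrable setT (EFin \o f).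
Proof.
move=> mf f0 fD; apply/integrableP; split; first exact/measurable_EFinP.
have cT : \bigcup_m (@cube R n m%:R) = setT.
  apply/seteqP; split=> // x _.
  have [M xM] := @obox_sub_cube R n (fun i => x ord0 i - 1) (fun i =>
    x ord0 i + 1).
  exists (Num.truncn M).+1 => //.
  apply: (@cube_le _ n M); first by rewrite ltW// Num.Theory.truncnS_gt.
  by apply: xM => i; rewrite in_itv/= ltrBlDr ltrDl ltr01.
have nd : nondecreasing_seq (fun m : nat => @cube R n m%:R).
  by move=> i j ij; apply/subsetPset/cube_le; rewrite ler_nat.
have mc (i : nat) : measurable (@cube R n i%:R) by exact: measurable_cube.
have mfc (i : nat) : measurable_fun (@cube R n i%:R) (EFin \o f).
  by apply/measurable_EFinP; exact: measurable_funS mf.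
have f0E (i : nat) x : @cube R n i%:R x -> (0 <= (EFin \o f) x)%E.
  by rewrite /= lee_fin.
have := @ge0_nondecreasing_set_cvg_integral _ _ _ _ _ mu nd mc mfc f0E.
rewrite cT => cv.
under eq_integral => x _ do rewrite /= ger0_norm//.
apply: (@le_lt_trans _ _ D%:E); last exact: ltry.
apply: (cvge_to_le cv).
apply: nearW => m; have [im leD] := fD m.
rewrite (_ : integral _ _ _ = \int[mu]_x (f x * \1_(cube m%:R) x)%:E)%E;
  last first.
  rewrite integral_mkcond; apply: eq_integral => x _; rewrite patchE indicE.
  by case: ifP => _; rewrite ?mulr1 ?mulr0.
have fin := integrable_fin_num measurableT im.
by rewrite -(fineK fin) lee_fin.
Qed.

(** Absorption: with X the integral of u^s phi_r, the equation gives c X <= a r^-2 times the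
    integral of u phi_r, where a = 9n, and Young's inequality bounds this by a K X + a e 2^n. A
    small K lets X be absorbed on the left, and the resulting bound does not depend on r. *)
Lemma serrin_integrable u h (s c : R) : H1 u -> {ae mu, forall x, 0 < u x} ->
  (forall x, 0 <= h x) -> 0 < c -> {ae mu, forall x, c * `|u x| `^ s <= h x} ->
  (forall r, 0 < r -> mu.-integrable setT (EFin \o (fun x =>
    h x * bumpr r x))) ->
  1 < s -> n%:R * (s - 1) <= 2 * s -> weak_solution 0 u h ->
  mu.-integrable setT (EFin \o (fun x => `|u x| `^ s)).
Proof.
move=> Hu u0 h0 c0 uh ih s1 ns wuh.
have mu_ := Lfun2_measurable Hu.1.
have mus : measurable_fun setT (fun x => `|u x| `^ s).
  apply: (measurableT_comp (measurable_powR s)).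
  exact: measurableT_comp.
have usb (r : R) : 0 < r -> mu.-integrable setT (EFin \o (fun x =>
  `|u x| `^ s * bumpr r x)).
  move=> r0; apply: (ae_le_integrable _ (integrableZ c^-1 (ih r r0))).
    apply: measurable_funM mus _.
    exact: (Lfun2_measurable (test_Lfun2 (bumpr_test r0))).
  apply: filterS uh => x hx; have b0 : 0 <= bumpr r x := bump_ge0 _ _ _ _.
  rewrite ger0_norm; last by rewrite mulr_ge0// powR_ge0.
  by rewrite mulrA ler_wpM2r// mulrC ler_pdivlMr// mulrC.
pose a : R := 9 * n%:R.
have a0 : 0 <= a by rewrite mulr_ge0.
(* Chosen so that a K <= c/2, leaving c X / 2 on the left; the factor a + 1 avoids a zero
   denominator. *)
pose K := c / (2 * (a + 1)).
have K0 : 0 < K by rewrite divr_gt0// mulr_gt0// ltr_wpDl.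
have aK : a * K <= c / 2.
  rewrite /K mulrA ler_pdivrMr ?mulr_gt0 ?ltr_wpDl//.
  by nra.
pose e := K `^ (- (s - 1)^-1).
pose D := 2 / c * (a * (e * 2 ^+ n)).
have XD r : 1 <= r -> \int[mu]_x (`|u x| `^ s * bumpr r x) <= D.
  move=> r1; have r0 : 0 < r by rewrite (lt_le_trans _ r1).
  have tb := @bumpr_test R n r r0.
  have iub := mul_test_integrable Hu.1 tb.
  have ib := bumpr_integrable r0.
  set X := \int[mu]_x _.
  have cX : c * X <= \int[mu]_x (h x * bumpr r x).
    rewrite -(RintegralZl c measurableT (usb r r0)).
    apply: (ae_le_Rintegral (integrableZ c (usb r r0)) (ih r r0)).
    by apply: filterS uh => x hx; rewrite mulrA ler_wpM2r// bump_ge0.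
  have := wuh _ (test_H1 tb); rewrite mul0r addr0 => E.
  have Y : \int[mu]_x (u x * bumpr r x) / r ^+ 2 <= K * X + e * 2 ^+ n.
    rewrite -(RintegralZr (r ^- 2) measurableT iub).
    apply: (@le_trans _ _ (\int[mu]_x
      (K * (`|u x| `^ s * bumpr r x) + e / r ^+ n * bumpr r x))).
      apply: ae_le_Rintegral.
      - rewrite (_ : EFin \o _ = EFin \o (fun x => r ^- 2 * (u x * bumpr r x))).
          exact: integrableZ.
        by apply/funext => x /=; rewrite mulrC.
      - exact: (integrableD _ (integrableZ K (usb r r0)) (integrableZ (e / r ^+
          n) ib)).
      apply: aeW => x; have b0 : 0 <= bumpr r x := bump_ge0 _ _ _ _.
      rewrite mulrA -mulrDl mulrAC ler_wpM2r//.
      apply: le_trans (young_scaled s1 ns K0 (normr_ge0 (u x)) r1).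
      by rewrite ler_wpM2r ?ler_norm// invr_ge0 exprn_ge0// (ltW r0).
    rewrite (RintegralD measurableT (integrableZ K (usb r r0)) (integrableZ (e
      / r ^+ n) ib)).
    rewrite (RintegralZl K measurableT (usb r r0)) (RintegralZl (e / r ^+
      n) measurableT ib).
    rewrite lerD2l; apply: (@le_trans _ _ (e / r ^+ n * (2 * r) ^+ n)).
      by rewrite ler_wpM2l ?integral_bumpr_le// divr_ge0 ?powR_ge0//
        exprn_ge0// (ltW r0).
    rewrite exprMn le_eqVlt; apply/orP; left; apply/eqP; field.
    by rewrite expf_neq0// gt_eqF.
  have {}cX : c * X <= a * (K * X + e * 2 ^+ n).
    apply: le_trans cX _; rewrite -E;
      apply: le_trans (grad_bumpr_le Hu u0 r0) _.
    apply: le_trans (ler_wpM2l a0 Y).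
    by rewrite mulrAC mulrA.
  have X0 : 0 <= X.
    by apply: Rintegral_ge0 => x _; rewrite mulr_ge0 ?powR_ge0// bump_ge0.
  have aKX := ler_wpM2r X0 aK.
  rewrite /D -invf_div [leRHS]mulrC ler_pdivlMr ?divr_gt0// mulrC.
  move: cX aKX; rewrite mulrDr mulrA.
  by move: (a * K * X) (a * (e * 2 ^+ n)) => y z ? ?; lra.
pose c1 : R := expR (- 3) ^+ n;
  have c10 : 0 < c1 by rewrite exprn_gt0// expR_gt0.
apply: (@integrable_of_cube_bound _ (c1^-1 * D)) => // m.
(* The cube of half-side m lies in that of half-side r/2 = m + 1, where the bump is at least
   [c1]. *)
pose r : R := 2 * m.+1%:R; have r1 : 1 <= r by rewrite /r -natrM ler1n.
have r0 : 0 < r by rewrite (lt_le_trans _ r1).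
have mc : measurable (@cube R n m%:R) by exact: measurable_cube.
have le1 x : `|u x| `^ s * \1_(cube m%:R) x <=
  c1^-1 * (`|u x| `^ s * bumpr r x).
  rewrite mulrCA ler_wpM2l ?powR_ge0//.
  have [mx|mx] := pselect (cube m%:R x); last first.
    by rewrite indicE memNset// mulr_ge0 ?bump_ge0// invr_ge0 (ltW c10).
  rewrite indicE mem_set// mulrC ler_pdivlMr// mul1r; apply: bumpr_ge => //.
  by apply: cube_le mx; rewrite /r mulrAC mulfV// mul1r ler_nat.
have im : mu.-integrable setT (EFin \o (fun x =>
  `|u x| `^ s * \1_(cube m%:R) x)).
  apply: (ae_le_integrable _ (integrableZ c1^-1 (usb r r0))).
    by apply: measurable_funM mus _; exact: measurable_indic.
  by apply: aeW => x; rewrite ger0_norm// mulr_ge0 ?powR_ge0.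
split=> //; apply: le_trans (ae_le_Rintegral im (integrableZ c1^-1 (usb r r0))
  (aeW _ le1)) _.
rewrite (RintegralZl c1^-1 measurableT (usb r r0)) ler_wpM2l ?XD//.
by rewrite invr_ge0 (ltW c10).
Qed.

End liouville.

(** * The two equations *)

Section schwarz.
Context {R : realType} {n : nat} (n_gt0 : (0 < n)%N).
Notation RN := 'rV[R]_n.
Notation mu := (lebesgue_rV R n).
Implicit Types (u v : RN -> R).

(** The profile in [schwarz_symmetric] is not constrained at 0, so the origin must be discarded as a
    null set. *)
Lemma ae_neq0 : {ae mu, forall x : RN, x != 0}.
Proof.
have E : [set 0 : RN] = [set x : RN | forall i, [set (0 : R)] (x ord0 i)].
  apply/seteqP; split=> [x -> i|x x0]; first by rewrite /= mxE.
  by apply/rowP => i; rewrite mxE; exact: x0.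
exists [set 0]; split.
- by rewrite E; apply: (measurable_rV_prod (A := fun=> [set (0 : R)])) => i;
    exact: measurable_set1.
- rewrite E; apply: etrans (lebesgue_rV_prod (A := fun=> [set (0 : R)]) _) _.
    by move=> i; exact: measurable_set1.
  by rewrite (bigD1 (Ordinal n_gt0))//= lebesgue_measure_set1 mul0e.
- by move=> x /= /negP; rewrite negbK => /eqP.
Qed.

Lemma enorm_ge (x : RN) (i : 'I_n) : `|x ord0 i| <= enorm x.
Proof.
rewrite -sqrtr_sqr /enorm ler_wsqrtr// (bigD1 i)//= lerDl.
by apply: sumr_ge0 => j _; rewrite sqr_ge0.
Qed.

Lemma enorm_gt0 (x : RN) : x != 0 -> 0 < enorm x.
Proof.
move=> /eqP x0; have [i xi] : exists i, x ord0 i != 0.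
  apply/not_existsP => h; apply: x0; apply/rowP => i; rewrite mxE.
  by apply/eqP; have := h i; case: eqP.
by apply: lt_le_trans (enorm_ge x i); rewrite normr_gt0.
Qed.

Lemma enorm_cube (x : RN) (r : R) : 0 < r -> cube r x -> enorm x <= n%:R * r.
Proof.
move=> r0 xr; have n1 : 1 <= n%:R :> R by rewrite ler1n.
rewrite -[leRHS]ger0_norm; last by rewrite mulr_ge0// ltW.
rewrite -sqrtr_sqr ler_wsqrtr//.
apply: (@le_trans _ _ (\sum_(i < n) r ^+ 2)).
  apply: ler_sum => i _; have := xr i; rewrite in_itv/= => /andP[x1 x2].
  by rewrite -[x ord0 i ^+ 2]real_normK ?num_real// lerXn2r ?nnegrE ?(ltW r0)//
    ler_norml !ltW.
rewrite sumr_const card_ord -[leLHS]mulr_natl exprMn ler_wpM2r ?sqr_ge0//.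
by rewrite expr2 ler_peMl.
Qed.

(** The box ]1, 2[^n keeps at distance at least 1 from the origin, where the profile may be
    unbounded. *)
Lemma schwarz_bounded u : schwarz_symmetric u ->
  exists2 C, 0 <= C & {ae mu, forall x, obox (fun=> 1) (fun=> 2) x -> u x <= C}.
Proof.
move=> [f [f0 fm uf]]; exists (f 1); first exact: f0.
apply: filterS uf => x -> x12; apply: fm => //.
have := x12 (Ordinal n_gt0); rewrite in_itv/= => /andP[x1 _].
apply: le_trans (enorm_ge x (Ordinal n_gt0)).
by rewrite (le_trans (ltW x1))// ler_norm.
Qed.

(** Points of the cube have norm at most s = n r, so monotonicity bounds [u] below by f(s). *)
Lemma schwarz_lower_bound u (r : R) : schwarz_symmetric u ->
  {ae mu, forall x, 0 < u x} -> 0 < r ->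
  exists2 c, 0 < c & {ae mu, forall x, cube r x -> c <= u x}.
Proof.
move=> [f [f0 fm uf]] u0 r0; pose s : R := n%:R * r.
have s0 : 0 < s by rewrite mulr_gt0// ltr0n.
exists (f s); last first.
  apply: filterS2 uf ae_neq0 => x -> x0 xr; apply: fm; first exact: enorm_gt0.
  exact: enorm_cube.
(* Positivity of f(s): a box of positive measure contains a point x of norm at least s at which u(x)
   = f(|x|) > 0, and f(s) >= f(|x|). *)
have [x [sx ux0 ufx]] : exists x, [/\ obox (fun=> s) (fun=> s + 1) x,
  0 < u x & u x = f (enorm x)].
  apply: contrapT => h.
  have : mu (obox (fun=> s) (fun=> s + 1)) = 0%E.
    have : {ae mu, forall x, ~ obox (fun=> s) (fun=> s + 1) x}.
      by apply: filterS2 u0 uf => x ux ufx sx; apply: h; exists x.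
    move=> [A [mA A0 hA]];
      apply: (subset_measure0 (measurable_obox _ _) mA _ A0).
    by move=> x sx; apply: hA => /=; exact.
  apply/eqP; rewrite gt_eqF//; apply: obox_gt0 => i; by rewrite ltrDl.
apply: (lt_le_trans ux0); rewrite ufx; apply: fm => //.
have := sx (Ordinal n_gt0); rewrite in_itv/= => /andP[x1 _].
apply: le_trans (enorm_ge x (Ordinal n_gt0)).
by rewrite (le_trans (ltW x1))// ler_norm.
Qed.

End schwarz.

(** * One equation of the system *)

Section component.
Context {R : realType} {n : nat}.
Notation RN := 'rV[R]_n.
Notation mu := (lebesgue_rV R n).
Implicit Types (u v : RN -> R).

(** The common shape of both right-hand sides. The first equation has A = alpha - 1 and B = beta;
    the second has A = beta - 1 and B = alpha, with [u] and [v] exchanged. *)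
Definition reaction (k g p A B : R) u v : RN -> R :=
  fun x => k * u x `^ (p - 1) + g * u x `^ A * v x `^ B.

(** If the integral diverges, [fine] makes both sides 0, because 0 to a positive power is 0. *)
Lemma Lpnorm_powR (p : R) u : 0 < p ->
  Lpnorm p u `^ p = \int[mu]_x (`|u x| `^ p).
Proof.
move=> p0; rewrite /Lpnorm /Rintegral unlock /=.
have I0 : (0 <= \int[mu]_x (`|u x| `^ p)%:E)%E.
  by apply: integral_ge0 => x _; rewrite lee_fin powR_ge0.
case: (\int[mu]_x (`|u x| `^ p)%:E)%E I0 => [r| |]//= r0.
  by rewrite -powRrM mulVf ?powRr1 ?gt_eqF.
by rewrite invr_eq0 (gt_eqF p0) /= powR0 ?gt_eqF.
Qed.

(** The last two conditions are n(t-1) <= 2t for t = 2 and t = p - 1. The second conclusion is the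
    equation tested with [u] itself; naming its two integrals keeps the final energy comparison
    linear. *)
Lemma component_positive (k g p A B lambda : R) u v :
  (0 < n)%N -> 0 < k -> 0 < g -> 2 < p -> 0 < A -> 0 < B ->
  H1 u -> H1 v -> {ae mu, forall x, 0 < u x} -> {ae mu, forall x, 0 < v x} ->
  schwarz_symmetric u -> schwarz_symmetric v ->
  weak_solution lambda u (reaction k g p A B u v) ->
  [/\ 0 <= lambda,
      lambda = 0 ->
        exists U I, [/\ U = \int[mu]_x (`|u x| `^ p),
          I = \int[mu]_x (`|u x| `^ (A + 1) * `|v x| `^ B) &
          dirichlet u = k * U + g * I],
      n%:R <= 4 :> R -> 0 < lambda &
      n%:R * (p - 2) <= 2 * (p - 1) -> 0 < lambda].
Proof.
move=> n0 k0 g0 p2 A0 B0 Hu Hv u0 v0 us vs uh.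
set h := reaction _ _ _ _ _ _ _ in uh.
have mu_ := Lfun2_measurable Hu.1; have mv := Lfun2_measurable Hv.1.
have mp (w : RN -> R) (e : R) : measurable_fun setT w ->
  measurable_fun setT (fun x => w x `^ e).
  by move=> mw; exact: measurableT_comp (measurable_powR e) mw.
have h1 x : 0 <= k * u x `^ (p - 1) by rewrite mulr_ge0 ?powR_ge0// ltW.
have h2 x : 0 <= g * u x `^ A * v x `^ B by rewrite !mulr_ge0 ?powR_ge0// ltW.
have h0 x : 0 <= h x by rewrite addr_ge0.
have mh : measurable_fun setT h.
  apply: measurable_funD; first by apply: measurable_funM => //; exact: mp.
  by apply: measurable_funM; [apply: measurable_funM => //|]; exact: mp.
have hp : {ae mu, forall x, 0 < h x}.
  apply: filterS u0 => x ux; rewrite ltr_pwDl//.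
  by rewrite mulr_gt0// powR_gt0.
have [Cu Cu0 uCu] := schwarz_bounded n0 us.
have [Cv Cv0 vCv] := schwarz_bounded n0 vs.
(* Away from the origin both Schwarz functions are bounded, hence so is [h]; this is the box that
   [rhs_mul_integrable] asks for. *)
have hC : {ae mu, forall x, obox (fun=> 1) (fun=> 2) x ->
    h x <= k * Cu `^ (p - 1) + g * Cu `^ A * Cv `^ B}.
  have le_powR (y C e : R) : 0 < e -> 0 < y -> y <= C -> y `^ e <= C `^ e.
    move=> e0 y0 yC; apply: ge0_ler_powR => //; first exact: ltW.
      by rewrite nnegrE ltW.
    by rewrite nnegrE (le_trans (ltW y0)).
  apply: filterS2 (filterI u0 v0) (filterI uCu vCv) => x [ux vx] [xu xv] xb.
  rewrite lerD//; first by rewrite ler_wpM2l ?(ltW k0)// le_powR ?xu//; lra.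
  by rewrite -!mulrA ler_wpM2l ?(ltW g0)// ler_pM ?powR_ge0// le_powR ?xu ?xv.
have lu : 0 < \int[mu]_x (u x * u x).
  have := @Rintegral_gt0 _ _ _ mu (fun x => u x * u x) (obox (fun=> 1) (fun=>
    2)).
  apply.
  - exact: Lfun2_mul_integrable Hu.1 Hu.1.
  - by apply: filterS u0 => x ux; rewrite mulr_ge0 ?(ltW ux).
  - exact: measurable_obox.
  - by apply: obox_gt0 => i; rewrite ltr1n.
  - by apply: filterS u0 => x ux _; rewrite mulr_gt0.
have ihu : mu.-integrable setT (EFin \o (fun x => h x * u x)).
  have ab (i : 'I_n) : (1 : R) < 2 by rewrite ltr1n.
  exact: (rhs_mul_integrable Hu u0 lu h0 mh hp uh ab hC).
have l0 : 0 <= lambda := multiplier_ge0 Hu u0 h0 uh.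
have ihb r : 0 < r -> mu.-integrable setT (EFin \o (fun x => h x * bumpr r x)).
  move=> r0; have [c c0 uc] := schwarz_lower_bound n0 us u0 r0.
  exact: (rhs_bumpr_integrable r0 c0 h0 mh uc ihu).
split=> //.
- move=> lambda0; do 2 eexists; split; [reflexivity|reflexivity|].
  have := uh u Hu; rewrite lambda0 mul0r addr0.
  have -> : \int[mu]_x (\sum_i weak_partial i u x * weak_partial i u x) =
    dirichlet u.
    by apply: eq_Rintegral => x _; apply: eq_bigr => i _; rewrite expr2.
  move=> ->.
  have ihu' := integrable_norm ihu.
  have ma : measurable_fun setT (fun x => `|u x|) by exact: measurableT_comp.
  have mav : measurable_fun setT (fun x => `|v x|) by exact: measurableT_comp.
  have uE x : 0 < u x -> u x `^ (p - 1) * u x = `|u x| `^ p.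
    by move=> ux; rewrite (gtr0_norm ux) mulrC mulr_powRB1 ?(ltW ux)//; lra.
  have vE x : 0 < u x -> 0 < v x -> u x `^ A * v x `^ B * u x = `|u x| `^ (A +
    1) * `|v x| `^ B.
    move=> ux vx; rewrite (gtr0_norm ux) (gtr0_norm vx) mulrAC; congr (_ * _).
    rewrite -[in RHS](mulr_powRB1 (ltW ux)) ?addrK; last by lra.
    by rewrite mulrC.
  have hE x : 0 < u x -> 0 < v x -> h x * u x =
      k * (`|u x| `^ p) + g * (`|u x| `^ (A + 1) * `|v x| `^ B).
    by move=> ux vx; rewrite -uE// -vE// /h /reaction; ring.
  have kU0 x : 0 <= k * (`|u x| `^ p) by apply:
    mulr_ge0 (ltW k0) (powR_ge0 _ _).
  have gI0 x : 0 <= g * (`|u x| `^ (A + 1) * `|v x| `^ B).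
    by apply: mulr_ge0 (ltW g0) _; rewrite mulr_ge0 ?powR_ge0.
  (* Both terms of h u are nonnegative, so each is dominated by h u and is integrable on its own;
     only then may the integral be split. *)
  have iU : mu.-integrable setT (EFin \o (fun x => `|u x| `^ p)).
    apply: (ae_le_integrable _ (integrableZ k^-1 ihu')); first exact: mp.
    apply: filterS2 u0 v0 => x ux vx; rewrite ger0_norm ?powR_ge0//.
    rewrite [leRHS]mulrC ler_pdivlMr// [leLHS]mulrC /= hE//.
    by rewrite (ger0_norm (addr_ge0 (kU0 x) (gI0 x))) lerDl.
  have iI : mu.-integrable setT (EFin \o (fun x => `|u x| `^ (A +
    1) * `|v x| `^ B)).
    apply: (ae_le_integrable _ (integrableZ g^-1 ihu')).
      by apply: measurable_funM; exact: mp.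
    apply: filterS2 u0 v0 => x ux vx; rewrite ger0_norm ?mulr_ge0 ?powR_ge0//.
    rewrite [leRHS]mulrC ler_pdivlMr// [leLHS]mulrC /= hE//.
    by rewrite (ger0_norm (addr_ge0 (kU0 x) (gI0 x))) lerDr.
  rewrite -(RintegralZl k measurableT iU) -(RintegralZl g measurableT iI).
  rewrite -(RintegralD measurableT (integrableZ k iU) (integrableZ g iI)).
  apply: ae_eq_Rintegral.
  - exact: measurable_funM.
  - exact: integrable_EFin_measurable (integrableD _ (integrableZ k iU)
      (integrableZ g iI)).
  - by apply: filterS2 u0 v0 => x ux vx; exact: hE.
(* Here t = 2, and membership of [u] in L^2 is part of H^1. *)
- move=> n4; rewrite lt_neqAle l0 andbT; apply/eqP => lambda0.
  rewrite -lambda0 in uh; apply: (liouville (t := 2) Hu u0 h0 hp ihb) uh.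
  + by rewrite ltr1n.
  + by lra.
  + have := Lfun2_integrable_sqr Hu.1.
    rewrite (_ : (fun x => u x ^+ 2) = (fun x => `|u x| `^ 2))//.
    by apply/funext => x; rewrite powR_mulrn// real_normK// num_real.
(* Here t = p - 1, which exceeds 1; the integrability of u^(p-1) comes from h >= k u^(p-1) through
   [serrin_integrable]. *)
- move=> np; rewrite lt_neqAle l0 andbT; apply/eqP => lambda0.
  rewrite -lambda0 in uh; apply: (liouville (t := p - 1) Hu u0 h0 hp ihb) (uh).
  + lra.
  + by move: np; rewrite (_ : p - 1 - 1 = p - 2)//; ring.
  + apply: (serrin_integrable Hu u0 h0 k0 _ ihb _ _ uh).
    * by apply: filterS u0 => x ux; rewrite ger0_norm ?(ltW ux)// /h lerDl.
    * lra.
    * by move: np; rewrite (_ : p - 1 - 1 = p - 2)//; ring.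
Qed.

End component.

(** The energy after both Dirichlet terms have been replaced by the nonlinear ones; [y] and [z]
    stand for the subcritical terms of J. The coupling is left with the coefficient (alpha + beta)/2
    - 1. *)
Lemma critical_energy_ge0 (R : realType) (mu1 mu2 nu alpha beta U V I y z : R) :
  y <= mu1 / 2 * U -> z <= mu2 / 2 * V -> 0 <= (alpha + beta - 2) * (nu * I) ->
  0 <= 2^-1 * (mu1 * U + nu * alpha * I + (mu2 * V + nu * beta * I)) -
       y - z - nu * I.
Proof. by move=> *; lra. Qed.

Theorem theorem1p5 (R : realType) (N : nat)
    (p q alpha beta mu1 mu2 a b nu0 k0 rho0 nu a1 b1 : R)
    (u0 v0 : 'rV[R]_N -> R) (lambda1 lambda2 : R)
    (hN : (3 <= N)%N)
    (hp : 2 < p < 2 + 4 / N%:R) (hq : 2 < q < 2 + 4 / N%:R)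
    (halpha : 1 < alpha) (hbeta : 1 < beta)
    (halphabeta : alpha + beta = 2 * N%:R / (N%:R - 2))
    (hmu1 : 0 < mu1) (hmu2 : 0 < mu2) (ha : 0 < a) (hb : 0 < b)
    (hnu0 : 0 < nu0) (hk0 : 0 < k0) (hrho0 : 0 < rho0)
    (hconst : local_min_geometry N p q alpha beta mu1 mu2 a b nu0 k0 rho0)
    (hnu : 0 < nu < nu0) (ha1 : 0 < a1 <= a) (hb1 : 0 < b1 <= b)
    (hA : Aset rho0 a1 b1 (u0, v0))
    (hu0 : {ae lebesgue_rV R N, forall x, 0 < u0 x})
    (hv0 : {ae lebesgue_rV R N, forall x, 0 < v0 x})
    (hu0s : schwarz_symmetric u0) (hv0s : schwarz_symmetric v0)
    (hmin : (energy p q alpha beta mu1 mu2 nu (u0, v0))%:E =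
            ground_level N p q alpha beta mu1 mu2 nu rho0 a1 b1)
    (heq1 : weak_solution lambda1 u0 (fun x =>
       mu1 * u0 x `^ (p - 1) + nu * alpha * u0 x `^ (alpha - 1) * v0 x `^ beta))
    (heq2 : weak_solution lambda2 v0 (fun x =>
       mu2 * v0 x `^ (q - 1) + nu * beta * u0 x `^ alpha * v0 x `^ (beta - 1))) :
  (N = 3%N \/ N = 4%N -> 0 < lambda1 /\ 0 < lambda2) /\
  ((5 <= N)%N ->
     [/\ 0 <= lambda1, 0 <= lambda2, 0 < lambda1 \/ 0 < lambda2,
         p <= (2 * N%:R - 2) / (N%:R - 2) -> 0 < lambda1
       & q <= (2 * N%:R - 2) / (N%:R - 2) -> 0 < lambda2]).
Proof.
have n0 : (0 < N)%N by rewrite (leq_trans _ hN).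
have N3 : 3 <= N%:R :> R by rewrite (ler_nat _ 3 N).
have /andP[p2 _] := hp; have /andP[q2 _] := hq; have /andP[nu_gt0 _] := hnu.
have [[Hu Hv _ _] _] := hA; rewrite /= in Hu Hv.
have A1 : 0 < alpha - 1 by rewrite subr_gt0.
have B1 : 0 < beta - 1 by rewrite subr_gt0.
have alpha0 : 0 < alpha by rewrite (lt_trans _ halpha).
have beta0 : 0 < beta by rewrite (lt_trans _ hbeta).
have [l1 z1 four1 ser1] := component_positive n0 hmu1 (mulr_gt0 nu_gt0 alpha0)
  p2 A1 beta0 Hu Hv hu0 hv0 hu0s hv0s heq1.
(* The second equation is the first with the two components exchanged, up to the order of the
   factors in the coupling term. *)
have [l2 z2 four2 ser2] : [/\ 0 <= lambda2,
    lambda2 = 0 -> exists U I, [/\ U = \int[lebesgue_rV R N]_x (`|v0 x| `^ q),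
      I = \int[lebesgue_rV R N]_x (`|v0 x| `^ (beta - 1 +
        1) * `|u0 x| `^ alpha) &
      dirichlet v0 = mu2 * U + nu * beta * I],
    N%:R <= 4 :> R -> 0 < lambda2 &
    N%:R * (q - 2) <= 2 * (q - 1) -> 0 < lambda2].
  apply: (component_positive n0 hmu2 (mulr_gt0 nu_gt0 beta0)
    q2 B1 alpha0 Hv Hu hv0 hu0 hv0s hu0s).
  move: heq2; congr weak_solution; apply/funext => x.
  by rewrite /reaction [in RHS]mulrAC.
(* Clearing the positive denominator N - 2 turns the threshold (2N-2)/(N-2) into the condition
   n(t-1) <= 2t for t = s - 1. *)
have serE (s : R) : s <= (2 * N%:R - 2) / (N%:R - 2) -> N%:R * (s - 2) <=
  2 * (s - 1).
  by rewrite ler_pdivlMr; [move=> ?; lra|lra].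
split=> [N34|_].
  have N4 : N%:R <= 4 :> R by rewrite (ler_nat _ N 4); case: N34 => ->.
  by split; [exact: four1|exact: four2].
split=> //; last 2 first.
- by move=> /serE; exact: ser1.
- by move=> /serE; exact: ser2.
have [E1|] := eqVneq lambda1 0; last by move=> ?; left;
  rewrite lt_neqAle eq_sym l1 andbT.
have [E2|] := eqVneq lambda2 0; last by move=> ?; right;
  rewrite lt_neqAle eq_sym l2 andbT.
exfalso.
have [U [I1 [UE I1E dU]]] := z1 E1; have [V [I2 [VE I2E dV]]] := z2 E2.
have U0 : 0 <= U by rewrite UE; apply: Rintegral_ge0 => x _; exact: powR_ge0.
have V0 : 0 <= V by rewrite VE; apply: Rintegral_ge0 => x _; exact: powR_ge0.
have I10 : 0 <= I1.
  by rewrite I1E; apply: Rintegral_ge0 => x _; rewrite mulr_ge0 ?powR_ge0.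
rewrite !subrK in I1E I2E.
have I2I1 : I2 = I1.
  by rewrite I1E I2E; apply: eq_Rintegral => x _; rewrite mulrC.
(* The level m_nu(a1, b1) is negative by the choice of the constants, and it is attained at (u0,
   v0). *)
have : energy p q alpha beta mu1 mu2 nu (u0, v0) < 0.
  have /andP[a10 a1a] := ha1; have /andP[b10 b1b] := hb1.
  have [||||J0 _] := hconst a1 b1 nu.
  - by rewrite (ltW a10).
  - by rewrite (ltW b10).
  - by rewrite xpair_eqE (gt_eqF a10).
  - exact: hnu.
  by rewrite -lte_fin hmin.
have pow_le (m r X : R) : 0 < m -> 2 < r -> 0 <= X -> m / r * X <= m / 2 * X.
  move=> m0 r2 X0; rewrite ler_wpM2r// ler_wpM2l ?(ltW m0)// lef_pV2 ?posrE//.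
    exact: ltW.
  exact: lt_trans r2.
have p0 : 0 < p by rewrite (lt_trans _ p2).
have q0 : 0 < q by rewrite (lt_trans _ q2).
rewrite /energy /= !Lpnorm_powR// -UE -VE -I1E dU dV I2I1 =>
  /lt_geF/negbT/negP; apply.
have ab : 0 <= (alpha + beta - 2) * (nu * I1).
  apply: mulr_ge0; last exact: mulr_ge0 (ltW nu_gt0) I10.
  by move: halpha hbeta; clear; lra.
by apply: critical_energy_ge0 ab; exact: pow_le.
Qed.
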